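(* Let $k=\overline{\mathbb{F}_2}$. Assume that for every $\alpha\in k\setminus\{0\}$ and all integers $n\ge 1$ and $0\le j<2^n$ one has $$\langle n,j,\alpha\rangle=e_{n+1}\left(g_\alpha^{2j+1}\right)-\tfrac12\left(e_{n+1}\left(g_\alpha^{2j}\right)+e_{n+1}\left(g_\alpha^{2j+2}\right)\right).$$ For $0\neq\alpha\in k$ let $G_\alpha=uv+g_\alpha\in k[x,y,z,u,v]$ and $R_\alpha=k[[x,y,z,u,v]]/(uv+g_\alpha)$. Then for every $0\ne\alpha\in k$: 1. For all integers $n$ with $1\le n<m_\alpha$, $e_n(G_\alpha)=\frac{45}{28}\cdot 2^{4n}-\frac37\cdot 2^{n+1}$. 2. $e_{HK}(R_\alpha)=\frac{767}{476}$ if $m_\alpha=1$, and $e_{HK}(R_\alpha)=\dfrac{45\cdot 2^{3m_\alpha}-38}{7\cdot 2^{3m_\alpha+2}-28}$ if $m_\alpha>1$. 3. $s(R_\alpha)=\frac{185}{476}$ if $m_\alpha=1$, and $s(R_\alpha)=\dfrac{11\cdot 2^{3m_\alpha}-18}{7\cdot 2^{3m_\alpha+2}-28}$ if $m_\alpha>1$.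
   Context: Let $k=\overline{\mathbb{F}_2}$; for $\beta\in k$ put $m_\beta=[\mathbb{F}_2(\beta):\mathbb{F}_2]$. For $0\ne\alpha\in k$ let $g_\alpha=\alpha x^2y^2+z^4+xyz^2+(x^3+y^3)z\in k[x,y,z]$. For a polynomial $f\in k[x_1,\dots,x_d]$ and $n\ge 0$, $e_n(f)=\dim_k k[x_1,\dots,x_d]/(x_1^{2^n},\dots,x_d^{2^n},f)$ (so $e_n(1)=0$); for $G_\alpha$ the ambient ring is $k[x,y,z,u,v]$ and for powers of $g_\alpha$ it is $k[x,y,z]$. Hilbert–Kunz multiplicity and $F$-signature: for a complete local $F$-finite domain $(R,\mathfrak m)$ of characteristic $p>0$, dimension $d$ and perfect residue field, $e_{HK}(R)=\lim_{e\to\infty}\ell_R(R/\mathfrak m^{[p^e]})/p^{ed}$ and $s(R)=\lim_{e\to\infty}\ell_R(R/I_e)/p^{ed}$, where $I_e=\{r\in R: \text{the }R\text{-linear map }R\to R^{1/p^e},\ 1\mapsto r^{1/p^e},\text{ does not split}\}$. Definition of $\langle n,j,\alpha\rangle$: let $0\neq\alpha\in k$, write $\alpha=\lambda^2+\lambda$ with $\lambda\in k$, and put $m=m_\alpha$. Let $P=$ ''even'', $Q=$ ''odd'' if $m_\lambda\ne m_\alpha$, and $P=$ ''odd'', $Q=$ ''even'' if $m_\lambda=m_\alpha$. Let $\Gamma$ be the free abelian group on symbols $A_n,B_n$ ($n\in\mathbb{N}$), $C$, $D$. Define homomorphisms $\sigma_0,\sigma_1:\Gamma\to\Gamma$ by: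 - $\sigma_0(A_n)=B_{n+1}$ if $m\mid n+1$ and $\frac{n+1}{m}$ has parity $P$; otherwise $\sigma_0(A_n)=A_{n+1}$. - $\sigma_1(A_n)=B_{n+1}$ if $m\mid n+1$ and $\frac{n+1}{m}$ has parity $Q$; otherwise $\sigma_1(A_n)=A_{n+1}$. - $\sigma_0(B_n)=0$ if $m\mid n$ and $\frac nm$ has parity $P$; otherwise $\sigma_0(B_n)=A_{n+1}+C$. - $\sigma_1(B_n)=0$ if $m\mid n$ and $\frac nm$ has parity $Q$; otherwise $\sigma_1(B_n)=A_{n+1}+C$. - $\sigma_0(C)=\sigma_1(C)=C$, $\sigma_0(D)=A_1$, $\sigma_1(D)=0$. For $n\ge0$ and $0\le j<2^n$ define $f(n,j)\in\Gamma$ recursively by $f(0,0)=2C+D$, $f(n+1,2j)=\sigma_0(f(n,j))$, $f(n+1,2j+1)=\sigma_1(f(n,j))$. Then $f(n,j)=aA_n+bB_n+cC+dD$ for some integers $a,b,c,d$, and $\langle n,j,\alpha\rangle:=(3a+5b+d)2^c$. *)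

(* Defs.v *)
(* mpoly has to be imported before the MathComp-Analysis files: their notation
   levels clash in the other order. *)
From HB Require Import structures.
From mathcomp Require Import all_boot all_order all_algebra all_field.
From mathcomp Require Import freeg mpoly.
From mathcomp Require Import boolp classical_sets reals topology normedtype
  sequences.

Set Implicit Arguments.
Unset Strict Implicit.
Unset Printing Implicit Defensive.

Import Order.TTheory GRing.Theory Num.Theory.
Import numFieldNormedType.Exports.

Local Open Scope classical_set_scope.
Local Open Scope ring_scope.

Section Dimension.
Variables (F : fieldType) (V : lmodType F).

Definition is_basis_mod (U W : set V) (n : nat) (b : 'I_n -> V) : Prop :=
  [/\ forall i, U (b i),
      forall v, U v -> exists c : 'I_n -> F, W (v - \sum_i c i *: b i)
    & forall c : 'I_n -> F, W (\sum_i c i *: b i) -> forall i, c i = 0].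

(* dim_F U/W for subspaces W of U, with value 0 when U/W is
   infinite-dimensional. *)
Definition dim_mod (U W : set V) : nat :=
  xget 0%N [set n | exists b : 'I_n -> V, is_basis_mod U W b].

End Dimension.

Section FieldDegree.
Variables (F K : fieldType) (iota : {rmorphism F -> K}).

(* K as an F-vector space through iota. *)
Definition restrict_scalars of {rmorphism F -> K} : Type := K.
Local Notation KF := (restrict_scalars iota).

HB.instance Definition _ := GRing.Field.on KF.

Definition restrict_scale (a : F) (x : KF) : KF := iota a * (x : K).

Fact restrict_scaleA a b x :
  restrict_scale a (restrict_scale b x) = restrict_scale (a * b) x.
Proof. by rewrite /restrict_scale rmorphM mulrA. Qed.

Fact restrict_scale1 : left_id 1 restrict_scale.
Proof. by move=> x; rewrite /restrict_scale rmorph1 mul1r. Qed.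

Fact restrict_scaleDr : right_distributive restrict_scale +%R.
Proof. by move=> a x y; rewrite /restrict_scale mulrDr. Qed.

Fact restrict_scaleDl x : {morph restrict_scale^~ x : a b / a + b}.
Proof. by move=> a b; rewrite /restrict_scale rmorphD mulrDl. Qed.

HB.instance Definition _ := GRing.Zmodule_isLmodule.Build F KF
  restrict_scaleA restrict_scale1 restrict_scaleDr restrict_scaleDl.

Definition adjoin (beta : K) : set K :=
  [set x | forall S : {pred K}, divring_closed S ->
     (forall a, iota a \in S) -> beta \in S -> x \in S].

Definition field_degree (beta : K) : nat :=
  dim_mod (adjoin beta : set KF) [set 0].

End FieldDegree.

Section Ideals.
Variable A : comNzRingType.

Definition is_ideal (I : set A) : Prop :=
  [/\ I 0, forall x y, I x -> I y -> I (x + y)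
    & forall a x, I x -> I (a * x)].

Definition ideal_gen (S : set A) : set A :=
  [set x | forall I, is_ideal I -> S `<=` I -> I x].

Fact ideal_gen_is_ideal S : is_ideal (ideal_gen S).
Proof.
split=> [I [] //|x y hx hy I hI SI|a x hx I hI SI].
- by have [_ hD _] := hI; apply: hD; [apply: hx|apply: hy].
- by have [_ _ hM] := hI; apply: hM; apply: hx.
Qed.

Fact ideal_gen1E (f x : A) : ideal_gen [set f] x <-> exists g, x = g * f.
Proof.
split=> [|[g ->] I [_ _ hM] fI]; last by apply: hM; apply: fI.
move=> /(_ [set y | exists g, y = g * f]); apply; last first.
  by move=> _ ->; exists 1; rewrite mul1r.
split; first by exists 0; rewrite mul0r.
- by move=> _ _ [g ->] [h ->]; exists (g + h); rewrite mulrDl.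
- by move=> a _ [g ->]; exists (a * g); rewrite mulrA.
Qed.

(* Ideals J_0 = I < J_1 < ... < J_n = A, i.e. a chain of length n of submodules
   of the A-module A/I. *)
Definition ideal_chain (I : set A) (n : nat) (J : nat -> set A) : Prop :=
  [/\ J 0%N = I, J n = setT,
      forall i, (i <= n)%N -> is_ideal (J i)
    & forall i, (i < n)%N -> J i `<` J i.+1].

(* The A-module A/I has (finite) length n. *)
Definition has_length_quot (I : set A) (n : nat) : Prop :=
  (exists J, ideal_chain I n J) /\
  (forall m J, ideal_chain I m J -> (m <= n)%N).

(* The maximal ideal, when A is local. *)
Definition nonunits : set A := [set x | ~ exists y, y * x = 1].

Definition frobenius_power (q : nat) (I : set A) : set A :=
  ideal_gen [set x ^+ q | x in I].

End Ideals.

Section PrincipalQuotient.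
Variables (A : comNzRingType) (f : A).

Definition principal_pred of nonunits f : {pred A} :=
  fun x => `[< ideal_gen [set f] x >].

Hypothesis f_nonunit : nonunits f.

Fact principal_idealr : idealr_closed (principal_pred f_nonunit).
Proof.
have [h0 hD hM] := ideal_gen_is_ideal [set f].
split; first exact/asboolP.
- apply/asboolP => /ideal_gen1E [g gf].
  by apply: f_nonunit; exists g; rewrite -gf.
- by move=> a u v /asboolP hu /asboolP hv; apply/asboolP; exact: (hD _ _ (hM a _ hu) hv).
Qed.

HB.instance Definition _ :=
  isIdealr.Build A (principal_pred f_nonunit) principal_idealr.

Definition principal_quot : comNzRingType :=
  {ideal_quot (principal_pred f_nonunit)}.

Fact principal_quot_pchar p : p \in [pchar A] -> p \in [pchar principal_quot].
Proof. exact: (rmorph_pchar (\pi_({ideal_quot (principal_pred f_nonunit)})%qT)). Qed.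

End PrincipalQuotient.

Section PthRoots.
Variables (p : nat) (A : comNzRingType).
Hypothesis pcharA : p \in [pchar A].

(* For a domain A of characteristic p, x |-> x^(p^e) is a ring isomorphism from
   A^(1/p^e) onto A.  So A^(1/p^e) is modelled by a copy of A, in which an
   element r stands for r^(1/p^e) and a : A acts as multiplication by
   a^(p^e). *)
Definition pth_roots (e : nat) of p \in [pchar A] : Type := A.
Variable e : nat.
Local Notation Aroot := (pth_roots e pcharA).

HB.instance Definition _ := GRing.Zmodule.on Aroot.

Definition pth_scale (a : A) (x : Aroot) : Aroot := a ^+ (p ^ e) * (x : A).

Fact pth_scaleA a b x : pth_scale a (pth_scale b x) = pth_scale (a * b) x.
Proof. by rewrite /pth_scale exprMn mulrA. Qed.

Fact pth_scale1 : left_id 1 pth_scale.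
Proof. by move=> x; rewrite /pth_scale expr1n mul1r. Qed.

Fact pth_scaleDr : right_distributive pth_scale +%R.
Proof. by move=> a x y; rewrite /pth_scale mulrDr. Qed.

Fact exprD_pchar (a b : A) n : (a + b) ^+ (p ^ n) = a ^+ (p ^ n) + b ^+ (p ^ n).
Proof.
elim: n a b => [|n IHn] a b; first by rewrite !expn0 !expr1.
by rewrite expnS !exprM -!(pFrobenius_autE pcharA)
   (pFrobenius_autD_comm _ (mulrC a b)) IHn.
Qed.

Fact pth_scaleDl x : {morph pth_scale^~ x : a b / a + b}.
Proof. by move=> a b; rewrite /pth_scale exprD_pchar mulrDl. Qed.

HB.instance Definition _ := GRing.Zmodule_isLmodule.Build A Aroot
  pth_scaleA pth_scale1 pth_scaleDr pth_scaleDl.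

Definition pth_root (r : A) : Aroot := r.

Definition root_map_splits (r : A) : Prop :=
  exists psi : {linear Aroot -> A^o},
    forall a : A, psi (a *: pth_root r) = a.

Definition nonsplit_ideal : set A := [set r | ~ root_map_splits r].

End PthRoots.

Section Multiplicities.
Variables (K : realType) (p d : nat) (A : comNzRingType).

(* In both definitions A is local of characteristic p and d stands for its
   dimension. *)
Definition is_HK_multiplicity (v : K) : Prop :=
  exists l : nat -> nat,
    (forall e, has_length_quot (frobenius_power (p ^ e) (@nonunits A)) (l e)) /\
    (fun e => (l e)%:R / (p ^ (e * d))%:R : K) @ \oo --> v.

Definition is_F_signature (pcharA : p \in [pchar A]) (v : K) : Prop :=
  exists l : nat -> nat,
    (forall e, has_length_quot (nonsplit_ideal pcharA e) (l e)) /\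
    (fun e => (l e)%:R / (p ^ (e * d))%:R : K) @ \oo --> v.

End Multiplicities.

(* Formal power series k[[x_1, ..., x_n]], as functions from exponents to
   coefficients. *)
Definition powerseries (n : nat) (k : comNzRingType) : Type := 'X_{1..n} -> k.

Section PowerSeries.
Variables (n : nat) (k : comNzRingType).
Local Notation S := (powerseries n k).
Implicit Types (a b c : S) (m : 'X_{1..n}).

HB.instance Definition _ := Choice.copy S ('X_{1..n} -> k).

Definition ps_zero : S := fun=> 0.
Definition ps_opp a : S := fun m => - a m.
Definition ps_add a b : S := fun m => a m + b m.

Fact ps_addA : associative ps_add.
Proof. by move=> a b c; apply/funext => m; rewrite /ps_add addrA. Qed.
Fact ps_addC : commutative ps_add.
Proof. by move=> a b; apply/funext => m; rewrite /ps_add addrC. Qed.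
Fact ps_add0 : left_id ps_zero ps_add.
Proof. by move=> a; apply/funext => m; rewrite /ps_add add0r. Qed.
Fact ps_addN : left_inverse ps_zero ps_opp ps_add.
Proof. by move=> a; apply/funext => m; rewrite /ps_add addNr. Qed.

HB.instance Definition _ :=
  GRing.isZmodule.Build S ps_addA ps_addC ps_add0 ps_addN.

Definition ps_one : S := fun m => (m == 0%MM)%:R.

Definition ps_mul a b : S := fun m =>
  \sum_(h : 'X_{1..n < (mdeg m).+1, (mdeg m).+1} | m == (h.1 + h.2)%MM)
     a h.1 * b h.2.

Definition ps_trunc (d : nat) a : {mpoly k[n]} :=
  \sum_(m : 'X_{1..n < d}) a m *: 'X_[m].

Fact ps_truncE d a m : (mdeg m < d)%N -> (ps_trunc d a)@_m = a m.
Proof. by move=> md; rewrite /ps_trunc mcoeff_mpoly. Qed.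

Fact mcoeffM_eq_low (p p' q q' : {mpoly k[n]}) m :
    (forall m', (mdeg m' <= mdeg m)%N -> p@_m' = p'@_m') ->
    (forall m', (mdeg m' <= mdeg m)%N -> q@_m' = q'@_m') ->
  (p * q)@_m = (p' * q')@_m.
Proof.
move=> pp' qq'; rewrite !mcoeffM; apply: eq_bigr => -[h1 h2] _ /=.
by rewrite pp' ?qq' // -ltnS bmdeg.
Qed.

Fact ps_mulE d a b m :
  (mdeg m < d)%N -> ps_mul a b m = (ps_trunc d a * ps_trunc d b)@_m.
Proof.
move=> md; rewrite mcoeffM; apply: eq_bigr => -[h1 h2] _ /=.
by rewrite !ps_truncE // (leq_trans _ md) // bmdeg.
Qed.

Fact ps_mulA : associative ps_mul.
Proof.
move=> a b c; apply/funext => m; rewrite !(@ps_mulE (mdeg m).+1) //.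
transitivity ((ps_trunc (mdeg m).+1 a *
  (ps_trunc (mdeg m).+1 b * ps_trunc (mdeg m).+1 c))@_m).
  apply: mcoeffM_eq_low => // m' m'm.
  by rewrite ps_truncE // (@ps_mulE (mdeg m).+1).
rewrite mulrA; apply: mcoeffM_eq_low => // m' m'm.
by rewrite ps_truncE // (@ps_mulE (mdeg m).+1).
Qed.

Fact ps_mulC : commutative ps_mul.
Proof.
by move=> a b; apply/funext => m; rewrite !(@ps_mulE (mdeg m).+1) // mulrC.
Qed.

Fact ps_mul1 : left_id ps_one ps_mul.
Proof.
move=> a; apply/funext => m; rewrite !(@ps_mulE (mdeg m).+1) //.
rewrite -[RHS](@ps_truncE (mdeg m).+1) // -[in RHS](mul1r (ps_trunc _ _)).
by apply: mcoeffM_eq_low => // m' m'm; rewrite ps_truncE // mcoeff1.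
Qed.

Fact ps_mulDl : left_distributive ps_mul ps_add.
Proof.
move=> a b c; apply/funext => m; rewrite /ps_add /ps_mul -big_split /=.
by apply: eq_bigr => h _; rewrite mulrDl.
Qed.

Fact ps_one_neq0 : ps_one != 0.
Proof.
apply/eqP => /(congr1 (fun a : S => a 0%MM)).
by rewrite /ps_one eqxx => /eqP; rewrite oner_eq0.
Qed.

HB.instance Definition _ := GRing.Zmodule_isComNzRing.Build S
  ps_mulA ps_mulC ps_mul1 ps_mulDl ps_one_neq0.

Definition ps_of_mpoly (p : {mpoly k[n]}) : S := fun m => p@_m.

Fact ps_of_mpoly_is_zmod_morphism : zmod_morphism ps_of_mpoly.
Proof. by move=> p q; apply/funext => m; rewrite /ps_of_mpoly mcoeffB. Qed.

Fact ps_of_mpoly_is_monoid_morphism : monoid_morphism ps_of_mpoly.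
Proof.
split=> [|p q]; apply/funext => m; rewrite /ps_of_mpoly; first exact: mcoeff1.
exact: mcoeffM.
Qed.

HB.instance Definition _ := GRing.isZmodMorphism.Build {mpoly k[n]} S
  ps_of_mpoly ps_of_mpoly_is_zmod_morphism.
HB.instance Definition _ := GRing.isMonoidMorphism.Build {mpoly k[n]} S
  ps_of_mpoly ps_of_mpoly_is_monoid_morphism.

Fact ps_mul_coef0 a b : (a * b) 0%MM = a 0%MM * b 0%MM.
Proof.
rewrite [LHS](@ps_mulE 1) ?mdeg0 // rmorphM /=.
by rewrite !ps_truncE ?mdeg0.
Qed.

Fact ps_nonunit a : a 0%MM = 0 -> nonunits a.
Proof.
move=> a0 [b /(congr1 (fun c : S => c 0%MM))].
rewrite ps_mul_coef0 a0 mulr0 => /esym /eqP.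
by rewrite [X in X == _]/(ps_one 0%MM) /ps_one eqxx oner_eq0.
Qed.

Fact ps_pchar p : p \in [pchar k] -> p \in [pchar S].
Proof.
move=> /(rmorph_pchar (@mpolyC n k)); exact: (rmorph_pchar ps_of_mpoly).
Qed.

End PowerSeries.

Section HilbertKunzFunction.
Variables (k : fieldType) (d : nat).

(* dim_k k[x_1, ..., x_d] / (x_1^(2^n), ..., x_d^(2^n), f); the 2 is the
   characteristic. *)
Definition e_ (n : nat) (f : {mpoly k[d]}) : nat :=
  dim_mod [set: {mpoly k[d]}]
    (ideal_gen ([set 'X_i ^+ (2 ^ n) | i in [set: 'I_d]] `|` [set f])).

End HilbertKunzFunction.

Section Hypersurfaces.
Variable k : fieldType.

Definition g_form (d : nat) (alpha : k) (x y z : {mpoly k[d]}) : {mpoly k[d]} :=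
  alpha *: (x ^+ 2 * y ^+ 2) + z ^+ 4 + x * y * z ^+ 2 + (x ^+ 3 + y ^+ 3) * z.

Definition g_ (alpha : k) : {mpoly k[3]} :=
  g_form alpha 'X_(inord 0) 'X_(inord 1) 'X_(inord 2).

Definition G_ (alpha : k) : {mpoly k[5]} :=
  'X_(inord 3) * 'X_(inord 4)
  + g_form alpha 'X_(inord 0) 'X_(inord 1) 'X_(inord 2).

Fact G_nonunit (alpha : k) : nonunits (ps_of_mpoly (G_ alpha)).
Proof.
have X0 (i : 'I_5) : mcoeff 0%MM ('X_i : {mpoly k[5]}) = 0.
  by rewrite mcoeffX mnm1_eq0.
apply: ps_nonunit; rewrite /ps_of_mpoly /G_ /g_form.
rewrite !(mcoeffD, mcoeffZ, rmorphM, rmorphD, rmorphXn) /= !X0.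
by rewrite !(expr0n, mulr0, mul0r, addr0).
Qed.

(* k[[x, y, z, u, v]] / (uv + g_alpha), a hypersurface in a regular local ring
   of dimension 5, hence of dimension 4. *)
Definition R_ (alpha : k) : comNzRingType := principal_quot (@G_nonunit alpha).

Fact R_pchar (alpha : k) p : p \in [pchar k] -> p \in [pchar R_ alpha].
Proof. by move=> pk; exact/principal_quot_pchar/ps_pchar. Qed.

End Hypersurfaces.

Inductive symbol : Type := SA of nat | SB of nat | SC | SD.

Definition symbol_code (s : symbol) : nat + nat + bool :=
  match s with
  | SA n => inl (inl n) | SB n => inl (inr n) | SC => inr true | SD => inr false
  end.

Definition symbol_decode (c : nat + nat + bool) : symbol :=
  match c with
  | inl (inl n) => SA n | inl (inr n) => SB n
  | inr true => SC | inr false => SD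
  end.

Fact symbol_codeK : cancel symbol_code symbol_decode. Proof. by case. Qed.

HB.instance Definition _ := Choice.copy symbol (can_type symbol_codeK).

(* The free abelian group on the symbols A_n, B_n, C, D. *)
Notation Gamma := {freeg symbol / int}.

Section Sigma.
(* Poddp is true when P = "odd" (and Q = "even"). *)
Variables (m : nat) (Poddp : bool).

(* m divides t and t / m has parity P (for i = false, used in sigma_0) or
   Q (for i = true, used in sigma_1). *)
Definition hits (i : bool) (t : nat) : bool :=
  (m %| t)%N && (odd (t %/ m) == Poddp (+) i).

Definition sigma_symbol (i : bool) (s : symbol) : Gamma :=
  match s with
  | SA n => if hits i n.+1 then << SB n.+1 >> else << SA n.+1 >>
  | SB n => if hits i n then 0 else << SA n.+1 >> + << SC >>
  | SC => << SC >>
  | SD => if i then 0 else << SA 1 >>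
  end.

Definition sigma (i : bool) : Gamma -> Gamma := fglift (sigma_symbol i).

Fixpoint f_ (n j : nat) : Gamma :=
  if n is n'.+1 then sigma (odd j) (f_ n' j./2) else << SC >> *+ 2 + << SD >>.

End Sigma.

Section Bracket.
Variables (k : closedFieldType) (iota : {rmorphism 'F_2 -> k}).

Fact pchar_closure : 2%N \in [pchar k].
Proof. exact/(rmorph_pchar iota)/pchar_Fp. Qed.

(* A solution lambda of alpha = lambda^2 + lambda.  One exists since k is
   algebraically closed; the other one, lambda + 1, has the same degree. *)
Definition artin_schreier_root (alpha : k) : k :=
  xget 0 [set lambda | alpha = lambda ^+ 2 + lambda].

Definition bracket (n j : nat) (alpha : k) : rat :=
  let m := field_degree iota alpha in
  let f := f_ m (field_degree iota (artin_schreier_root alpha) == m) n j in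
  (3 * coeff (SA n) f + 5 * coeff (SB n) f + coeff SD f)%:~R * 2 ^ coeff SC f.

End Bracket.

(* Main.v *)
Require Import Defs.
From HB Require Import structures.
From mathcomp Require Import all_boot all_order all_algebra all_field.
From mathcomp Require Import freeg mpoly.
From mathcomp Require Import boolp classical_sets reals topology normedtype
  sequences.
From mathcomp Require Import ring lra zify.

(** Why the theorem holds.  Put [q = 2^n], let [B] be the ring
    [k[x,y,z]/(x^q, y^q, z^q)], so that [e_n(g^j)] is the dimension of
    [B/(g^j)], and write [t = uv].

    - Grading by the degree in [u] minus the degree in [v] splits
      [k[x,y,z,u,v]/(x^q, ..., v^q)] into pieces [B[t]/(t^(q - d))], one for
      [d = 0] and two for each [0 < d < q].  Modulo [G = t + g] such a piece
      becomes [B/(g^(q - d))] ([box_ideal_G]), hence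
      [e_n(G) = sum_(j < q) (e_n(g^j) + e_n(g^(j+1)))] ([e_G]).  The Frobenius
      map is flat, so [e_(n+1)(g^(2j)) = 8 e_n(g^j)] ([e_double]), and the
      hypothesis expresses the odd powers by the even ones and the brackets.
      This gives the recursion
      [e_(n+1)(G) = 16 e_n(G) + 2 sum_j <n,j,alpha>] ([e_G_rec]).

    - The brackets need not be known individually.  At each step at most one of
      [sigma_0], [sigma_1] treats a symbol exceptionally, and a sum over all [j]
      is symmetric in the two; thus the contributions of the [A_n] and of the
      [B_n] to the sum satisfy a linear recursion governed by the divisibility
      of [n] by [m] ([sumA_rec], [sumB_rec]).  Solving it yields
      closed forms for [e_n(G)] ([e_G_gt1] for [m > 1], [e_G_eq1] for [m = 1]),
      from which the first claim and the limit of [e_n(G)/16^n] are read off.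

    - Colengths of ideals in the power series ring are dimensions over [k]
      ([length_of_codim]), and the Frobenius powers of the maximal ideal of [R]
      come from [(x^q, ..., v^q, G)] ([frobenius_power_R]).  So the
      Hilbert-Kunz multiplicity is the limit just computed.

    - By the Fedder criterion the ideal [I_e] of [R] comes from the colon ideal
      [(x^q, ..., v^q) : G^(q-1)] ([nonsplit_R]), so its colength is the rank of
      the multiplication by [G^(q-1)] on the truncated ring.  On a piece as above
      this rank is that of [g^d] on [B] ([ann_Gq]), that is [q^3 - e_n(g^d)];
      summing over the pieces gives [2 q^4 - e_n(G)] ([codim_ann_Gq]).  Hence the
      F-signature is [2] minus the Hilbert-Kunz multiplicity.

    Throughout, polynomial rings are replaced by power series rings, on which the
    coordinates over the subring of [q]-th powers are explicit maps of
    coefficients ([cartier]). *)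

Set Implicit Arguments.
Unset Strict Implicit.
Unset Printing Implicit Defensive.

Import Order.TTheory GRing.Theory Num.Theory.
Import numFieldNormedType.Exports.

Local Open Scope classical_set_scope.
Local Open Scope ring_scope.

(** * Codimension of a subspace *)

Section Codimension.
Variable k : fieldType.

(** Stated by a coordinate map with kernel [W] rather than by a basis of the
    quotient, because coordinate maps compose with linear and semilinear maps. *)
Definition codim (V : lmodType k) (W : set V) (n : nat) : Prop :=
  exists phi : {linear V -> 'rV[k]_n},
    (forall v, W v <-> phi v = 0) /\ (forall y, exists v, phi v = y).

Lemma codim_coords (V : lmodType k) (W : set V) (I : finType)
    (phi : V -> I -> k) :
  (forall a u v i, phi (a *: u + v) i = a * phi u i + phi v i) ->
  (forall v, W v <-> forall i, phi v i = 0) ->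
  (forall y : I -> k, exists v, forall i, phi v i = y i) ->
  codim W #|I|.
Proof.
move=> phiL phiW phi_surj.
pose f v : 'rV[k]_#|I| := \row_j phi v (enum_val j).
have fL : linear f by move=> a u v; apply/rowP => j; rewrite !mxE phiL.
pose F : {linear V -> 'rV[k]_#|I|} :=
  HB.pack f (GRing.isLinear.Build k V 'rV[k]_#|I| _ f fL).
exists F; split=> [v|y].
  rewrite phiW; split=> [v0|/rowP v0 i].
    by apply/rowP => j; rewrite !mxE v0.
  by have := v0 (enum_rank i); rewrite !mxE enum_rankK.
have [v vE] := phi_surj (fun i => y 0 (enum_rank i)).
by exists v; apply/rowP => j; rewrite mxE vE enum_valK.
Qed.

(** The coordinate vectors of a family independent modulo [W] are the rows of a
    row-free matrix. *)
Lemma codim_indep_leq (V : lmodType k) (W : set V) n m (b : 'I_m -> V) :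
  codim W n -> (forall c, W (\sum_i c i *: b i) -> forall i, c i = 0) ->
  (m <= n)%N.
Proof.
move=> [phi [phiW _]] b_free; pose M := \matrix_i phi (b i).
suff : row_free M by rewrite /row_free => /eqP <-; apply: rank_leq_col.
apply: inj_row_free => v vM; apply/rowP => i; rewrite mxE.
apply: (b_free (fun i => v 0 i)); apply/phiW; rewrite linear_sum -[RHS]vM.
by rewrite mulmx_sum_row; apply: eq_bigr => j _; rewrite rowK linearZ.
Qed.

Lemma codim_basis (V : lmodType k) (W : set V) n :
  codim W n -> exists b : 'I_n -> V, is_basis_mod setT W b.
Proof.
move=> [phi [phiW phi_surj]].
have [b bE] := choice (fun i : 'I_n => phi_surj (delta_mx 0 i)).
have phi_comb (c : 'I_n -> k) : phi (\sum_i c i *: b i) = \row_i c i.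
  rewrite linear_sum [RHS]row_sum_delta.
  by apply: eq_bigr => i _; rewrite linearZ /= bE mxE.
exists b; split=> // [v _|c /phiW].
  exists (fun i => phi v 0 i); apply/phiW; rewrite linearB /= phi_comb.
  by apply/eqP; rewrite subr_eq0; apply/eqP/rowP => i; rewrite mxE.
by rewrite phi_comb => /rowP c0 i; have := c0 i; rewrite !mxE.
Qed.

Lemma codim_leq (V : lmodType k) (W : set V) n m :
  codim W n -> codim W m -> (m <= n)%N.
Proof.
by move=> Wn /codim_basis [b [_ _ bW]]; apply: (codim_indep_leq Wn bW).
Qed.

Lemma codim_uniq (V : lmodType k) (W : set V) n m :
  codim W n -> codim W m -> n = m.
Proof. by move=> Wn Wm; apply/eqP; rewrite eqn_leq !(@codim_leq _ W). Qed.

Lemma basis_mod_card (V : lmodType k) (W : set V) n m (b : 'I_m -> V) :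
  codim W n -> is_basis_mod setT W b -> m = n.
Proof.
move=> Wn [_ b_span b_free].
apply/eqP; rewrite eqn_leq (codim_indep_leq Wn b_free) /=.
have [phi [phiW phi_surj]] := Wn; pose M := \matrix_i phi (b i).
suff /eqP <- : row_full M by apply: rank_leq_row.
apply/row_fullP.
have rowM i : exists r : 'rV_m, r *m M = delta_mx 0 i.
  have [v vi] := phi_surj (delta_mx 0 i).
  have [c /phiW] := b_span v I.
  rewrite linearB linear_sum => /eqP; rewrite subr_eq0 vi => /eqP ->.
  exists (\row_i c i); rewrite mulmx_sum_row; apply: eq_bigr => j _.
  by rewrite rowK linearZ mxE.
have [r rE] := choice rowM.
exists (\matrix_i r i); apply/row_matrixP => i.
by rewrite row_mul rowK rE row1.
Qed.

Lemma codim_dim_mod (V : lmodType k) (W : set V) n :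
  codim W n -> dim_mod setT W = n.
Proof.
move=> Wn; rewrite /dim_mod; case: xgetP => [m _ /= [b]|].
  exact: basis_mod_card.
by move=> /(_ n) []; apply: codim_basis.
Qed.

(** Rank-nullity in the two forms needed for multiplication by a ring element:
    for [M] itself this is the codimension of a kernel, for [cokermx M] that of
    an image. *)
Lemma codim_rank (V : lmodType k) N p (rho : {linear V -> 'rV[k]_N})
    (M : 'M[k]_(N, p)) :
  (forall y, exists v, rho v = y) -> codim [set v | rho v *m M = 0] (\rank M).
Proof.
move=> rho_surj; pose f v := rho v *m col_base M.
have fL : linear f by move=> a u v; rewrite /f linearP mulmxDl scalemxAl.
pose F : {linear V -> 'rV[k]_(\rank M)} :=
  HB.pack f (GRing.isLinear.Build k V 'rV[k]_(\rank M) _ f fL).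
exists F; split=> [v /=|y].
  rewrite /f -{1}(mulmx_base M) mulmxA; split=> [|->]; last by rewrite mul0mx.
  move=> /eqP; rewrite mulmx_free_eq0 ?row_base_free //.
  by move/eqP.
have /row_fullP [B BM] := col_base_full M.
have [v vE] := rho_surj (y *m B); exists v.
by rewrite /= /f vE -mulmxA BM mulmx1.
Qed.

Lemma codim_image (V : lmodType k) N p (rho : {linear V -> 'rV[k]_N})
    (M : 'M[k]_(p, N)) :
  (forall y, exists v, rho v = y) ->
  codim [set v | exists y, rho v = y *m M] (N - \rank M)%N.
Proof.
move=> rho_surj; rewrite -mxrank_coker.
have -> : [set v | exists y, rho v = y *m M] =
          [set v | rho v *m cokermx M = 0].
  apply/seteqP; split=> v /=.
    by move=> [y ->]; rewrite -mulmxA mulmx_coker mulmx0.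
  by move=> /eqP; rewrite -submxE => /submxP.
exact: codim_rank.
Qed.

(** Codimensions add up along a decomposition of [V] modulo [W] into pieces.  The
    components may be semilinear, since composing their coordinates with [tau]
    makes them linear again: squaring is used for [tau] when a series is split
    into its coordinates over the subring of squares. *)
Lemma codim_family (V V' : lmodType k) (tau : {rmorphism k -> k}) (T : finType)
    (Phi : T -> V -> V') (W : set V) (W' : T -> set V') (n : T -> nat) :
  (forall x, exists y, tau y = x) ->
  (forall c, codim (W' c) (n c)) ->
  (forall c a u v, Phi c (tau a *: u + v) = a *: Phi c u + Phi c v) ->
  (forall v, W v <-> forall c, W' c (Phi c v)) ->
  (forall y : T -> V', exists v, forall c, W' c (Phi c v - y c)) ->
  codim W (\sum_c n c)%N.
Proof.
move=> tau_surj Wn PhiL PhiW Phi_surj; have [r rE] := choice tau_surj.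
have -> : (\sum_c n c)%N = #|{: {c : T & 'I_(n c)}}|.
  rewrite card_tagged sumnE big_map big_enum.
  by apply: eq_bigr => c _; rewrite card_ord.
pose phi c := sval (cid (Wn c)).
have phiW c v : W' c v <-> phi c v = 0 by have [] := svalP (cid (Wn c)).
have phi_surj c y : exists v, phi c v = y by have [] := svalP (cid (Wn c)).
apply: (@codim_coords V W {c : T & 'I_(n c)}
          (fun v s => tau (phi (tag s) (Phi (tag s) v) 0 (tagged s)))).
- by move=> a u v s; rewrite -{1}(rE a) PhiL linearP !mxE rmorphD rmorphM rE.
- move=> v; rewrite PhiW; split=> [Wv s|v0 c].
    by have /phiW -> := Wv (tag s); rewrite mxE rmorph0.
  apply/phiW/rowP => i; apply: (fmorph_inj tau).
  by rewrite (v0 (Tagged (fun c => 'I_(n c)) i)) mxE rmorph0.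
move=> y.
have [z zE] := choice (fun c => phi_surj c
  (\row_i r (y (Tagged (fun c => 'I_(n c)) i)))).
have [v vE] := Phi_surj z; exists v => -[c i] /=.
have /phiW := vE c; rewrite linearB => /eqP; rewrite subr_eq0 => /eqP ->.
by rewrite zE mxE rE.
Qed.

End Codimension.

(** * Formal power series *)

Section PowerSeriesTheory.
Variables (n : nat) (k : fieldType).
Local Notation S := (powerseries n k).
Implicit Types (a b s t : S) (m h : 'X_{1..n}).

Definition ps_scale (c : k) a : S := fun m => c * a m.

Fact ps_scaleA c c' a : ps_scale c (ps_scale c' a) = ps_scale (c * c') a.
Proof. by apply/funext => m; rewrite /ps_scale mulrA. Qed.
Fact ps_scale1 : left_id 1 ps_scale.
Proof. by move=> a; apply/funext => m; rewrite /ps_scale mul1r. Qed.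
Fact ps_scaleDr : right_distributive ps_scale +%R.
Proof. by move=> c a b; apply/funext => m; apply: mulrDr. Qed.
Fact ps_scaleDl a : {morph ps_scale^~ a : c c' / c + c'}.
Proof. by move=> c c'; apply/funext => m; apply: mulrDl. Qed.

HB.instance Definition _ := GRing.Zmodule_isLmodule.Build k S
  ps_scaleA ps_scale1 ps_scaleDr ps_scaleDl.

Definition psX h : S := ps_of_mpoly 'X_[h].
Definition psC (c : k) : S := ps_of_mpoly c%:MP.

Lemma psD a b m : (a + b) m = a m + b m. Proof. by []. Qed.
Lemma psN a m : (- a) m = - a m. Proof. by []. Qed.
Lemma psB a b m : (a - b) m = a m - b m. Proof. by []. Qed.
Lemma ps0 m : (0 : S) m = 0. Proof. by []. Qed.
Lemma ps1 m : (1 : S) m = (m == 0%MM)%:R. Proof. by []. Qed.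
Lemma psZ c a m : (c *: a) m = c * a m. Proof. by []. Qed.

Lemma ps_sum (I : Type) (r : seq I) (P : pred I) (F : I -> S) m :
  (\sum_(i <- r | P i) F i) m = \sum_(i <- r | P i) F i m.
Proof. by elim/big_rec2: _ => //= i y x _ <-. Qed.

Lemma psXE h m : psX h m = (h == m)%:R. Proof. exact: mcoeffX. Qed.

Lemma psX0 : psX 0%MM = 1.
Proof. by rewrite /psX mpolyX0 rmorph1. Qed.

Lemma psXD h h' : psX (h + h')%MM = psX h * psX h'.
Proof. by rewrite /psX mpolyXD rmorphM. Qed.

Lemma lem_mdeg m h : (h <= m)%MM -> (mdeg h <= mdeg m)%N.
Proof. by move=> /mnm_lepP hm; rewrite !mdegE; apply: leq_sum. Qed.

Lemma ps_mul_ext a a' b b' m :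
    (forall h, (h <= m)%MM -> a h = a' h) ->
    (forall h, (h <= m)%MM -> b h = b' h) ->
  (a * b) m = (a' * b') m.
Proof.
move=> aa' bb'; apply: eq_bigr => -[h1 h2] /= /eqP mE.
have := lem_addr h1 h2; have := lem_addl h1 h2.
by rewrite -mE => /bb' -> /aa' ->.
Qed.

Lemma ps_mul_eq0 a b m :
  (forall h h', m = (h + h')%MM -> a h * b h' = 0) -> (a * b) m = 0.
Proof. by move=> ab0; apply: big1 => -[h1 h2] /= /eqP /ab0. Qed.

Lemma ps_mul_trunc a b m D : (mdeg m < D)%N ->
  (a * b) m = (ps_of_mpoly (ps_trunc D a) * b) m.
Proof.
move=> mD; apply: ps_mul_ext => // h /lem_mdeg hm.
by rewrite /ps_of_mpoly ps_truncE // (leq_ltn_trans hm).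
Qed.

Lemma ps_mulX a h m : (a * psX h) m = if (h <= m)%MM then a (m - h)%MM else 0.
Proof.
case: ifPn => [hm|hm].
  rewrite (@ps_mul_trunc _ _ _ (mdeg m).+1) // -rmorphM /= /ps_of_mpoly.
  rewrite -{1}(submK hm) addmC mcoeffMX ps_truncE // ltnS.
  by apply/lem_mdeg/lem_subr.
apply: ps_mul_eq0 => h1 h2 mE; rewrite psXE.
case: eqP => [hE|]; last by rewrite mulr0.
by move: hm; rewrite mE hE lem_addl.
Qed.

Lemma psCM c a : psC c * a = c *: a.
Proof.
apply/funext => m; rewrite psZ mulrC (@ps_mul_trunc _ _ _ (mdeg m).+1) //.
by rewrite -rmorphM /= /ps_of_mpoly mulrC mcoeffCM ps_truncE.
Qed.

Lemma psZAl c a b : c *: (a * b) = (c *: a) * b.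
Proof. by rewrite -!psCM mulrA. Qed.

Lemma psZAr c a b : c *: (a * b) = a * (c *: b).
Proof. by rewrite mulrC psZAl mulrC. Qed.

Lemma ps_mul0 a b : (a * b) 0%MM = a 0%MM * b 0%MM.
Proof. exact: ps_mul_coef0. Qed.

Lemma ps_exp_order t i m : t 0%MM = 0 -> (mdeg m < i)%N -> (t ^+ i) m = 0.
Proof.
move=> t0; elim: i m => [|i IHi] m //; rewrite ltnS exprS => mi.
apply: ps_mul_eq0 => h h' mE.
have [->|h0] := eqVneq h 0%MM; first by rewrite t0 mul0r.
rewrite IHi ?mulr0 // (leq_trans _ mi) // mE mdegD.
by rewrite -{1}(add0n (mdeg h')) ltn_add2r lt0n mdeg_eq0.
Qed.

(** The inverse is the geometric series in [1 - a / a(0)], which is a finite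
    sum in each degree. *)
Lemma ps_unit a : a 0%MM != 0 -> exists b, b * a = 1.
Proof.
move=> a0; pose t : S := 1 - (a 0%MM)^-1 *: a.
have t0 : t 0%MM = 0 by rewrite /t psB psZ ps1 eqxx mulVf // subrr.
pose b : S := fun m => (\sum_(i < (mdeg m).+1) t ^+ i) m.
exists ((a 0%MM)^-1 *: b); rewrite -psZAl psZAr.
have -> : (a 0%MM)^-1 *: a = 1 - t by rewrite opprB addrC subrK.
apply/funext => m; pose D := (mdeg m).+1.
rewrite (@ps_mul_ext _ (\sum_(i < D) t ^+ i) _ (1 - t)) //; last first.
  move=> h /lem_mdeg hm; rewrite /b !ps_sum /D.
  rewrite -!(big_mkord xpredT (fun i => (t ^+ i) h)).
  rewrite [RHS](@big_cat_nat _ _ _ (mdeg h).+1) //= [X in _ + X]big_nat_cond.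
  rewrite [X in _ + X]big1 ?addr0 // => i /andP [/andP [hi _] _].
  exact: ps_exp_order.
have -> : (\sum_(i < D) t ^+ i) * (1 - t) = 1 - t ^+ D.
  by rewrite mulrC -[in LHS]opprB mulNr -subrX1 opprB.
by rewrite psB ps_exp_order ?subr0.
Qed.

Lemma ps_nonunitP a : nonunits a <-> a 0%MM = 0.
Proof.
split=> [a_nonunit|]; last exact: ps_nonunit.
by apply/eqP; apply: contra_notT a_nonunit; apply: ps_unit.
Qed.

(** * Series supported outside a box of exponents *)

(** The monomials outside the box generate the ideal [(x_1^q, ..., x_n^q)], so
    [box0 q] is that ideal, described by coefficients; see [box0_gen]. *)
Definition in_box (q : nat) m : bool := [forall i, (m i < q)%N].

Definition box0 (q : nat) : set S := [set a | forall m, in_box q m -> a m = 0].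

Lemma in_box_leq q m h : (h <= m)%MM -> in_box q m -> in_box q h.
Proof.
move=> /mnm_lepP hm /forallP mq; apply/forallP => i.
exact: leq_ltn_trans (hm i) (mq i).
Qed.

Lemma box0_ideal q : is_ideal (box0 q).
Proof.
split=> [//|a b a0 b0 m mq|a b b0 m mq]; first by rewrite psD a0 // b0 // addr0.
apply: ps_mul_eq0 => h h' mE; rewrite b0 ?mulr0 //.
by apply: in_box_leq mq; rewrite mE lem_addl.
Qed.

Lemma box0_0 q : box0 q 0. Proof. by []. Qed.

Lemma box0D q a b : box0 q a -> box0 q b -> box0 q (a + b).
Proof. by have [_ + _] := box0_ideal q; apply. Qed.

Lemma box0M q a b : box0 q b -> box0 q (a * b).
Proof. by have [_ _] := box0_ideal q; apply. Qed.

Lemma box0N q a : box0 q a -> box0 q (- a).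
Proof. by move=> a0 m mq; rewrite psN a0 ?oppr0. Qed.

Lemma box0B q a b : box0 q a -> box0 q b -> box0 q (a - b).
Proof. by move=> a0 b0; apply/box0D/box0N. Qed.

Lemma box0Z q c a : box0 q a -> box0 q (c *: a).
Proof. by move=> a0 m mq; rewrite psZ a0 ?mulr0. Qed.

Lemma box0X q m : ~~ in_box q m -> box0 q (psX m).
Proof.
move=> mq h hq; rewrite psXE; case: eqP => // mh; by rewrite mh hq in mq.
Qed.

Lemma psXn i q : psX U_(i) ^+ q = psX (U_(i) *+ q)%MM.
Proof. by rewrite /psX -rmorphXn mpolyXn. Qed.

(** A monomial outside the box is charged to the first variable whose exponent
    is at least [q]. *)
Lemma box0_gen q a :
  box0 q a -> exists t : 'I_n -> S, a = \sum_i t i * psX U_(i) ^+ q.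
Proof.
move=> a0.
pose low (i : 'I_n) m := [forall j : 'I_n, (j < i)%N ==> (m j < q)%N].
exists (fun i m => if low i m then a (m + U_(i) *+ q)%MM else 0).
have UE i (j : 'I_n) : (U_(i) *+ q)%MM j = (if i == j then q else 0)%N.
  by rewrite mulmnE mnm1E; case: eqP => _; rewrite ?mul1n ?mul0n.
have lemU i m : (U_(i) *+ q <= m)%MM = (q <= m i)%N.
  apply/mnm_lepP/idP => [/(_ i)|qm j]; first by rewrite UE eqxx.
  by rewrite UE; case: eqP => // <-.
apply/funext => m; rewrite ps_sum.
under eq_bigr => i _ do rewrite psXn ps_mulX lemU.
have [mq|] := boolP (in_box q m).
  rewrite a0 // big1 // => i _; rewrite ifN // -ltnNge.
  exact: (forallP mq).
rewrite negb_forall => /existsP [i0]; rewrite -leqNgt => i0q.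
have [i iq imin] :=
  @arg_minnP _ i0 (fun i => q <= m i)%N (fun i => i : nat) i0q.
rewrite (bigD1 i) //= iq big1 ?addr0 => [|j ji]; last first.
  case: ifP => // jq; rewrite ifN //; apply/negP => /forallP /(_ i).
  rewrite ltn_neqAle (imin _ jq) andbT eq_sym (inj_eq val_inj) ji /=.
  by rewrite mnmBE UE (negPf ji) subn0 ltnNge iq.
rewrite ifT ?submK ?lemU //; apply/forallP => j; apply/implyP => ji.
rewrite mnmBE (leq_ltn_trans (leq_subr _ _)) // ltnNge; apply/negP => /imin.
by rewrite leqNgt ji.
Qed.

(** The case [q = 1] of [box0_gen], where the box is reduced to the exponent
    zero. *)
Lemma ps_coef0_gen a :
  exists t : 'I_n -> S, a = psC (a 0%MM) + \sum_i t i * psX U_(i).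
Proof.
have [|t tE] := @box0_gen 1 (a - psC (a 0%MM)).
  move=> m m1; have -> : m = 0%MM.
    by apply/mnmP => i; have := forallP m1 i; rewrite mnm0E; case: (m i).
  by rewrite psB /psC /ps_of_mpoly mcoeffC eqxx mulr1 subrr.
exists t; under eq_bigr do rewrite -[psX _]expr1.
by rewrite -tE addrC subrK.
Qed.

End PowerSeriesTheory.

(** * Monomials with bounded exponents *)

Section BoxMonomials.
Variables (n e : nat).
Local Notation q := (2 ^ e)%N.
Implicit Types (m h : 'X_{1..n}).

Lemma q_gt0 : (0 < q)%N. Proof. by rewrite expn_gt0. Qed.

Lemma mnm0_muln N : (0 *+ N)%MM = 0%MM :> 'X_{1..n}.
Proof. by apply/mnmP => j; rewrite mulmnE mnm0E. Qed.

Definition box_index := {ffun 'I_n -> 'I_q}.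

Definition box_mon (t : box_index) : 'X_{1..n} := [multinom (t j : nat) | j < n].

Lemma box_monP t : in_box q (box_mon t).
Proof. by apply/forallP => j; rewrite mnmE. Qed.

Lemma mnm_divmod m : exists m' t, m = (m' *+ q + box_mon t)%MM.
Proof.
exists [multinom (m j %/ q)%N | j < n].
exists [ffun j => Ordinal (ltn_pmod (m j) q_gt0)]; apply/mnmP => j.
by rewrite mnmDE mulmnE !mnmE ffunE /= -divn_eq.
Qed.

Lemma in_boxP m : in_box q m -> exists t, m = box_mon t.
Proof.
move=> /forallP mq; exists [ffun j => Ordinal (mq j)].
by apply/mnmP => j; rewrite mnmE ffunE.
Qed.

Lemma card_box_index : #|{: box_index}| = (q ^ n)%N.
Proof. by rewrite card_ffun !card_ord. Qed.

Lemma box_mon_inj t t' m m' :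
  (m *+ q + box_mon t = m' *+ q + box_mon t')%MM -> m = m' /\ t = t'.
Proof.
move=> E; have Ej j : (m j * q + t j = m' j * q + t' j)%N.
  by have := congr1 (fun h : 'X_{1..n} => h j) E; rewrite !mnmDE !mulmnE !mnmE.
have eq_m j : m j = m' j by have := Ej j; have := ltn_ord (t j); have := ltn_ord (t' j); nia.
split; first by apply/mnmP.
by apply/ffunP => j; apply/val_inj; have := Ej j; rewrite eq_m => /addnI.
Qed.

Lemma box_mon_inj0 : injective box_mon.
Proof.
move=> t t' E; have [|_ //] := @box_mon_inj t t' 0%MM 0%MM.
by rewrite mnm0_muln !add0m.
Qed.

End BoxMonomials.

(** * The Frobenius basis of the power series ring *)

Section Frobenius.
Variables (n : nat) (k : closedFieldType) (pchar_k : 2%N \in [pchar k]).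
Local Notation S := (powerseries n k).
Implicit Types (a b s : S) (m h : 'X_{1..n}).

Let pchar_S : 2%N \in [pchar S] := ps_pchar n pchar_k.

Section Exponent.
Variable e : nat.
Local Notation q := (2 ^ e)%N.

Definition qroot (c : k) : k := xget 0 [set r | r ^+ q = c].

Lemma qrootK c : qroot c ^+ q = c.
Proof.
rewrite /qroot; case: xgetP => [r _ //|none].
have [r rE] := solve_monicpoly (fun i => if i == 0%N then c else 0) (q_gt0 e).
case: (none r); rewrite /= rE; case: q (q_gt0 e) => // p _.
by rewrite big_ord_recl big1 /= ?expr0 ?mulr1 ?addr0 // => i _; rewrite mul0r.
Qed.

Lemma qroot_unique c r : r ^+ q = c -> r = qroot c.
Proof.
rewrite -{1}(qrootK c) => /eqP; rewrite -subr_eq0.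
rewrite (oppr_pchar2 pchar_k) -(exprD_pchar pchar_k) expf_eq0 (q_gt0 e) /=.
by rewrite addr_eq0 (oppr_pchar2 pchar_k) => /eqP.
Qed.

Lemma qrootD c d : qroot (c + d) = qroot c + qroot d.
Proof.
by apply/esym/qroot_unique; rewrite (exprD_pchar pchar_k) !qrootK.
Qed.

Lemma qrootM c d : qroot (c ^+ q * d) = c * qroot d.
Proof. by apply/esym/qroot_unique; rewrite exprMn qrootK. Qed.

Lemma qroot0 : qroot 0 = 0.
Proof. by apply/esym/qroot_unique; rewrite expr0n -leqn0 leqNgt (q_gt0 e). Qed.

Lemma qroot1 : qroot 1 = 1.
Proof. by apply/esym/qroot_unique; rewrite expr1n. Qed.

(** The [i]-th coordinate of [s] in the basis of monomials with exponents below
    [q] of the power series ring over its [q]-th powers. *)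
Definition cartier (i : 'X_{1..n}) s : S := fun m => qroot (s (m *+ q + i)%MM).

Lemma cartierD i a b : cartier i (a + b) = cartier i a + cartier i b.
Proof. by apply/funext => m; rewrite /cartier psD qrootD. Qed.

Lemma cartier0 i : cartier i 0 = 0.
Proof. by apply/funext => m; rewrite /cartier ps0 qroot0. Qed.

Lemma cartier_sum i (I : Type) (r : seq I) (F : I -> S) :
  cartier i (\sum_(j <- r) F j) = \sum_(j <- r) cartier i (F j).
Proof. by apply: (big_morph (cartier i)) => [a b|]; rewrite ?cartierD ?cartier0. Qed.

Lemma cartierN i a : cartier i (- a) = - cartier i a.
Proof.
by apply/eqP; rewrite -[_ == _]subr_eq0 opprK -cartierD addNr cartier0.
Qed.

Lemma cartierB i a b : cartier i (a - b) = cartier i a - cartier i b.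
Proof. by rewrite cartierD cartierN. Qed.

Lemma cartierZ i c a : cartier i (c ^+ q *: a) = c *: cartier i a.
Proof. by apply/funext => m; rewrite /cartier !psZ qrootM. Qed.

Let cartierX i h s : in_box q i ->
  cartier i (psX k h ^+ q * s) = psX k h * cartier i s.
Proof.
move=> /forallP iq; apply/funext => m.
have -> : psX k h ^+ q = psX k (h *+ q)%MM by rewrite /psX -rmorphXn mpolyXn.
rewrite /cartier ![_ * s]mulrC ![psX k h * _]mulrC !ps_mulX.
have -> : (h *+ q <= m *+ q + i)%MM = (h <= m)%MM.
  apply/mnm_lepP/mnm_lepP => hm j; have := hm j; have := iq j; have := (q_gt0 e);
  rewrite !mnmDE !mulmnE; nia.
case: ifP => [/mnm_lepP hm|_]; last by rewrite qroot0.
congr (qroot (s _)); apply/mnmP => j; have := hm j; have := iq j.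
rewrite !(mnmDE, mnmBE, mulmnE); nia.
Qed.

Let high D a := forall m, (mdeg m < D)%N -> a m = 0.

Let highM D a b : high D a -> high D (a * b).
Proof.
move=> aD m mD; apply: ps_mul_eq0 => h h' mE; rewrite aD ?mul0r //.
by rewrite (leq_ltn_trans _ mD) // mE mdegD leq_addr.
Qed.

(** On a monomial [a] this is a shift of coefficients, and additivity extends it
    to polynomials.  A given coefficient of either side only sees finitely many
    coefficients of [a]. *)
Lemma cartierM i a s : in_box q i -> cartier i (a ^+ q * s) = a * cartier i s.
Proof.
move=> iq; have cartier_poly (p : {mpoly k[n]}) :
    cartier i (ps_of_mpoly p ^+ q * s) = ps_of_mpoly p * cartier i s.
  elim/mpolyind: p => [|c h p _ _ IHp].
    by rewrite rmorph0 expr0n -[_ == 0%N]negbK -lt0n (q_gt0 e) !mul0r cartier0.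
  rewrite rmorphD (exprD_pchar pchar_S) !mulrDl cartierD IHp; congr (_ + _).
  rewrite -mul_mpolyC rmorphM /= exprMn -mulrA -!rmorphXn /=.
  rewrite -/(@psC n k (c ^+ q)) psCM -psZAl cartierZ rmorphXn /= cartierX //.
  by rewrite -psCM mulrA.
apply/funext => m; pose D := (mdeg (m *+ q + i)%MM).+1.
(* only the coefficients of a of degree < D contribute to degree mdeg m *)
have [p [r [-> rD]]] : exists p r, a = ps_of_mpoly p + r /\ high D r.
  exists (ps_trunc D a), (a - ps_of_mpoly (ps_trunc D a)).
  split; first by rewrite addrC subrK.
  by move=> h hD; rewrite psB /ps_of_mpoly ps_truncE // subrr.
have mD : (mdeg m < D)%N.
  rewrite ltnS mdegD mdegMn; have := (q_gt0 e); nia.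
rewrite (exprD_pchar pchar_S) !mulrDl cartierD cartier_poly !psD.
congr (_ + _); rewrite [RHS](highM _ rD) // /cartier (@highM D) ?qroot0 //.
by case: (q) (q_gt0 e) => // N _; rewrite exprS; apply: highM.
Qed.

Lemma cartier_mon (t t' : box_index n e) :
  cartier (box_mon t) (psX k (box_mon t')) = (t == t')%:R.
Proof.
apply/funext => m; rewrite /cartier psXE.
have -> : (box_mon t' == m *+ q + box_mon t)%MM = (t == t') && (m == 0%MM).
  apply/eqP/andP => [E|[/eqP -> /eqP ->]]; last by rewrite mnm0_muln add0m.
  have [|-> ->] := @box_mon_inj n e t t' m 0%MM; last by [].
  by rewrite -E mnm0_muln add0m.
case: eqP => _ /=; last by rewrite qroot0.
by rewrite mulr1n ps1; case: eqP => _; rewrite ?qroot1 ?qroot0.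
Qed.

Lemma cartier_eq0 s : (forall t : box_index n e, cartier (box_mon t) s = 0) -> s = 0.
Proof.
move=> s0; apply/funext => m; have [m' [t ->]] := mnm_divmod e m.
have := congr1 (fun a : S => a m' ^+ q) (s0 t).
by rewrite /cartier qrootK ps0 expr0n -[_ == 0%N]negbK -lt0n (q_gt0 e).
Qed.

Lemma cartier_comb (y : box_index n e -> S) t :
  cartier (box_mon t) (\sum_u y u ^+ q * psX k (box_mon u)) = y t.
Proof.
rewrite cartier_sum (bigD1 t) //= big1 => [|u ut].
  by rewrite cartierM ?box_monP // cartier_mon eqxx mulr1 addr0.
by rewrite cartierM ?box_monP // cartier_mon eq_sym (negPf ut) mulr0.
Qed.

(** Both sides have the same coordinates. *)
Lemma cartier_decomp s :
  s = \sum_(t : box_index n e) cartier (box_mon t) s ^+ q * psX k (box_mon t).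
Proof.
apply/eqP; rewrite -subr_eq0; apply/eqP/cartier_eq0 => t.
by rewrite cartierB cartier_comb subrr.
Qed.

Lemma box0_cartier s :
  box0 q s <-> forall t : box_index n e, cartier (box_mon t) s 0%MM = 0.
Proof.
split=> [s0 t|s0 m /in_boxP [t ->]].
  by rewrite /cartier mnm0_muln add0m s0 ?qroot0 // box_monP.
have := congr1 (fun c => c ^+ q) (s0 t).
by rewrite /cartier qrootK mnm0_muln add0m expr0n -[_ == 0%N]negbK -lt0n (q_gt0 e).
Qed.

(** Every coordinate of [s^q] is a multiple of [s]. *)
Lemma box0_exp s : s 0%MM = 0 -> box0 q (s ^+ q).
Proof.
move=> s0; apply/box0_cartier => t; rewrite -[_ ^+ q]mulr1 cartierM ?box_monP //.
by rewrite ps_mul0 s0 mul0r.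
Qed.

End Exponent.

(** The ideal [(x_1^q, ..., x_n^q, f)]; by [box0_gen] its first [n] generators
    give [box0 q]. *)
Definition box_ideal q (f : S) : set S := [set a | exists b, box0 q (a - b * f)].

Lemma box_ideal_ideal q f : is_ideal (box_ideal q f).
Proof.
split=> [|a b [a' aE] [b' bE]|a b [b' bE]].
- by exists 0; rewrite mul0r subr0.
- by exists (a' + b'); rewrite mulrDl opprD addrACA; apply: box0D.
- by exists (a * b'); rewrite -mulrA -mulrBr; apply: box0M.
Qed.

Lemma box_ideal0 q f a : box0 q a -> box_ideal q f a.
Proof. by exists 0; rewrite mul0r subr0. Qed.

Lemma box0_double e s :
  box0 (2 ^ e.+1) s <-> forall t : box_index n 1, box0 (2 ^ e) (cartier 1 (box_mon t) s).
Proof.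
have boxE m (t : box_index n 1) :
    in_box (2 ^ e.+1) (m *+ (2 ^ 1) + box_mon t)%MM = in_box (2 ^ e) m.
  apply: eq_forallb => j; rewrite (expnS 2 e) expn1 mnmDE mulmnE mnmE.
  have : (t j < 2)%N := ltn_ord (t j).
  by move: (2 ^ e)%N => q; lia.
split=> [s0 t m mq|s0 m]; first by rewrite /cartier s0 ?qroot0 // boxE.
have [m' [t ->]] := mnm_divmod 1 m; rewrite boxE => /(s0 t) E.
have := congr1 (fun c => c ^+ (2 ^ 1)) E.
by rewrite /cartier qrootK expr0n.
Qed.

(** Taking coordinates over the subring of squares turns multiplication by [f^2]
    into multiplication by [f]. *)
Lemma box_ideal_double e f a :
  box_ideal (2 ^ e.+1) (f ^+ 2) a <->
  forall t : box_index n 1, box_ideal (2 ^ e) f (cartier 1 (box_mon t) a).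
Proof.
have cartierE b (t : box_index n 1) : cartier 1 (box_mon t) (b * f ^+ 2) = cartier 1 (box_mon t) b * f.
  by rewrite mulrC (cartierM f b (box_monP t)) mulrC.
split=> [[b /box0_double ab] t|/choice [b bE]].
  by exists (cartier 1 (box_mon t) b); rewrite -cartierE -cartierB.
exists (\sum_t b t ^+ (2 ^ 1) * psX k (box_mon t)); apply/box0_double => t.
by rewrite cartierB cartierE cartier_comb.
Qed.

(** Flatness of the Frobenius map: the power series ring is free of rank [2^n]
    over its subring of squares. *)
Lemma codim_double e f N : codim (box_ideal (2 ^ e) f) N ->
  codim (box_ideal (2 ^ e.+1) (f ^+ 2)) (2 ^ n * N).
Proof.
move=> fN; have <- : (\sum_(t : box_index n 1) N = 2 ^ n * N)%N.
  by rewrite sum_nat_const card_box_index.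
apply: (@codim_family _ _ _ (pFrobenius_aut pchar_k) _
  (fun t : box_index n 1 => cartier 1 (box_mon t)) _ (fun=> box_ideal (2 ^ e) f)) => //.
- by move=> x; exists (qroot 1 x); rewrite /= pFrobenius_autE (qrootK 1).
- by move=> t c u v; rewrite cartierD /= pFrobenius_autE (cartierZ 1).
- exact: box_ideal_double.
move=> y; exists (\sum_t y t ^+ (2 ^ 1) * psX k (box_mon t)) => t.
by rewrite cartier_comb subrr; apply: box_ideal0.
Qed.

End Frobenius.

(** * Hilbert-Kunz functions in terms of power series *)

Section HilbertKunz.
Variables (n : nat) (k : closedFieldType).
Local Notation S := (powerseries n k).
Implicit Types (a b f : S) (m h : 'X_{1..n}).

Lemma box_coords e : exists rho : {linear S -> 'rV[k]_((2 ^ e) ^ n)},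
  (forall y, exists a, rho a = y) /\ (forall a, rho a = 0 <-> box0 (2 ^ e) a).
Proof.
have [//|||phi [phiW phi_surj]] := @codim_coords k S (box0 (2 ^ e)) (box_index n e)
    (fun a t => a (box_mon t)).
- move=> a; split=> [a0 t|a0 m /in_boxP [t ->] //].
  by apply: a0; apply: box_monP.
- move=> y; exists (fun m => \sum_(t | box_mon t == m) y t) => t.
  by rewrite (big_pred1 t) // => u; rewrite /= (inj_eq (@box_mon_inj0 n e)).
- by rewrite -(card_box_index n e); exists phi; split=> // a; rewrite phiW.
Qed.

(** Multiplication by [f] on the truncated ring has both its kernel and its
    image described by the same matrix. *)
Lemma codim_mul e f : exists N,
  [/\ (N <= (2 ^ e) ^ n)%N, codim (box_ideal (2 ^ e) f) N
    & codim [set a | box0 (2 ^ e) (a * f)] ((2 ^ e) ^ n - N)].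
Proof.
have [rho [rho_surj rho0]] := box_coords e.
have rhoB a b : rho a = rho b <-> box0 (2 ^ e) (a - b).
  rewrite -rho0 linearB; split=> [->|/eqP]; first by rewrite subrr.
  by rewrite subr_eq0 => /eqP.
have [b bE] := choice (fun i => rho_surj (delta_mx 0 i)).
pose M := \matrix_i rho (b i * f).
have rhoM a : rho (a * f) = rho a *m M.
  have -> : rho a *m M = rho ((\sum_i rho a 0 i *: b i) * f).
    rewrite mulr_suml linear_sum mulmx_sum_row; apply: eq_bigr => i _.
    by rewrite rowK -psZAl linearZ.
  apply/rhoB; rewrite -mulrBl mulrC; apply/box0M/rhoB.
  rewrite linear_sum {1}[rho a]row_sum_delta; apply: eq_bigr => i _.
  by rewrite linearZ /= bE.
exists ((2 ^ e) ^ n - \rank M)%N; split; first exact: leq_subr.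
  have -> : box_ideal (2 ^ e) f = [set a | exists y, rho a = y *m M].
    apply/seteqP; split=> a /= [y].
      by move=> /rhoB ->; rewrite rhoM; exists (rho y).
    by have [c <-] := rho_surj y; rewrite -rhoM => /rhoB; exists c.
  exact: codim_image.
rewrite subKn ?rank_leq_row //.
have -> : [set a | box0 (2 ^ e) (a * f)] = [set a | rho a *m M = 0].
  by apply/seteqP; split=> a /=; rewrite -rhoM rho0.
exact: codim_rank.
Qed.

Lemma in_box_mdeg q m : in_box q m -> (mdeg m < (n * q).+1)%N.
Proof.
move=> /forallP mq; rewrite ltnS mdegE.
apply: (@leq_trans (\sum_(i < n) q)); last by rewrite sum_nat_const card_ord.
by apply: leq_sum => i _; apply: ltnW.
Qed.

Lemma box0_trunc q a : box0 q (a - ps_of_mpoly (ps_trunc (n * q).+1 a)).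
Proof.
by move=> m mq; rewrite psB /ps_of_mpoly ps_truncE ?subrr // in_box_mdeg.
Qed.

(** A power series differs from a polynomial by an element of [box0 q], so
    completing the polynomial ring does not change the quotient. *)
Lemma box_ideal_mpoly q (f p : {mpoly k[n]}) :
  box_ideal q (ps_of_mpoly f) (ps_of_mpoly p) <->
  ideal_gen ([set 'X_i ^+ q | i in [set: 'I_n]] `|` [set f]) p.
Proof.
set gens := _ `|` _; have [gen0 genD genM] := ideal_gen_is_ideal gens.
have genP (x : {mpoly k[n]}) : gens x -> ideal_gen gens x by move=> gx I _; apply.
split=> [[b bE]|pI]; last first.
  apply: (pI [set p | box_ideal q (ps_of_mpoly f) (ps_of_mpoly p)]).
    have [I0 ID IM] := box_ideal_ideal q (ps_of_mpoly f).
    split=> [|x y|x y]; rewrite /= ?rmorph0 ?rmorphD ?rmorphM //.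
    - exact: ID.
    - exact: IM.
  move=> _ [[i _ <-]|->] /=; last by exists 1; rewrite mul1r subrr.
  apply: box_ideal0; rewrite mpolyXn; apply: box0X.
  by apply/forallPn; exists i; rewrite mulmnE mnm1E eqxx mul1n ltnn.
pose c := ps_trunc (n * q).+1 b.
have {bE} : box0 q (ps_of_mpoly (p - c * f)).
  have -> : ps_of_mpoly (p - c * f) = ps_of_mpoly p - b * ps_of_mpoly f
      + (b - ps_of_mpoly c) * ps_of_mpoly f.
    by rewrite rmorphB rmorphM /=; ring.
  by apply: box0D => //; rewrite mulrC; apply/box0M/box0_trunc.
move: (p - c * f) (subrK (c * f) p) => r <- r0.
apply: (genD); last by apply: genM; apply: genP; right.
rewrite [r]mpolyE; apply: big_ind => [|x y|m _]; [exact: gen0|exact: genD|].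
have [mq|] := boolP (in_box q m).
  have -> : r@_m = 0 by apply: r0.
  by rewrite scale0r.
move=> /forallPn [i]; rewrite -leqNgt => qi.
have -> : r@_m *: 'X_[m] = (r@_m *: 'X_[m - U_(i) *+ q]) * 'X_i ^+ q.
  rewrite mpolyXn -scalerAl -mpolyXD submK //; apply/mnm_lepP => j.
  by rewrite mulmnE mnm1E; case: eqP => [<-|]; rewrite ?mul1n ?mul0n.
by apply: genM; apply: genP; left; exists i.
Qed.

Lemma codim_e e N (f : {mpoly k[n]}) :
  codim (box_ideal (2 ^ e) (ps_of_mpoly f)) N -> e_ e f = N.
Proof.
move=> fN; apply: codim_dim_mod.
have <- : (\sum_(i < 1) N = N)%N by rewrite big_ord1.
apply: (@codim_family _ _ _ idfun _ (fun=> @ps_of_mpoly n k) _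
  (fun=> box_ideal (2 ^ e) (ps_of_mpoly f))) => //.
- by move=> x; exists x.
- by move=> _ a u v; apply/funext => m; rewrite /ps_of_mpoly linearP.
- by move=> p; rewrite -box_ideal_mpoly; split=> [|/(_ ord0)].
move=> y; exists (ps_trunc (n * 2 ^ e).+1 (y ord0)) => i.
rewrite (ord1 i); apply: box_ideal0; rewrite -opprB.
exact/box0N/box0_trunc.
Qed.

Lemma codim_box_ideal e (f : {mpoly k[n]}) :
  codim (box_ideal (2 ^ e) (ps_of_mpoly f)) (e_ e f).
Proof.
by have [N [_ fN _]] := codim_mul e (ps_of_mpoly f); rewrite (codim_e fN).
Qed.

Lemma e_leq e (f : {mpoly k[n]}) : (e_ e f <= (2 ^ e) ^ n)%N.
Proof. by have [N [N_leq fN _]] := codim_mul e (ps_of_mpoly f); rewrite (codim_e fN). Qed.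

Lemma codim_ann e (f : {mpoly k[n]}) :
  codim [set a | box0 (2 ^ e) (a * ps_of_mpoly f)] ((2 ^ e) ^ n - e_ e f).
Proof.
by have [N [_ fN annN]] := codim_mul e (ps_of_mpoly f); rewrite (codim_e fN).
Qed.

Lemma e_one e : e_ e (1 : {mpoly k[n]}) = 0%N.
Proof.
suff /codim_e -> : codim (box_ideal (2 ^ e) (ps_of_mpoly (1 : {mpoly k[n]}))) 0 by [].
pose z : {linear S -> 'rV[k]_0} := \0; exists z; split=> [a|y].
  by split=> // _; exists a; rewrite rmorph1 mulr1 subrr => m.
by exists 0; rewrite [LHS]thinmx0 [RHS]thinmx0.
Qed.

(** Such an [f] acts as zero on the truncated ring. *)
Lemma e_box0 e (f : {mpoly k[n]}) :
  box0 (2 ^ e) (ps_of_mpoly f) -> e_ e f = ((2 ^ e) ^ n)%N.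
Proof.
move=> f0; have annT : [set a | box0 (2 ^ e) (a * ps_of_mpoly f)] = setT.
  by apply/seteqP; split=> // a _; apply: box0M.
have := codim_ann e f; rewrite annT => fT.
have : codim (setT : set S) 0.
  pose z : {linear S -> 'rV[k]_0} := \0; exists z; split=> //.
  by move=> y; exists 0; rewrite [LHS]thinmx0 [RHS]thinmx0.
move=> /(codim_uniq fT) /eqP; rewrite subn_eq0 => le_e.
by apply/eqP; rewrite eqn_leq e_leq.
Qed.

Lemma e_double e (f : {mpoly k[n]}) : 2%N \in [pchar k] ->
  e_ e.+1 (f ^+ 2) = (2 ^ n * e_ e f)%N.
Proof.
move=> pchar_k; apply: codim_e; rewrite rmorphXn.
exact/(codim_double pchar_k)/codim_box_ideal.
Qed.

End HilbertKunz.

(** * Splitting off the variables u and v *)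

Section Slices.
Variables (k : closedFieldType) (pchar_k : 2%N \in [pchar k]).
Local Notation S3 := (powerseries 3 k).
Local Notation S5 := (powerseries 5 k).
Implicit Types (a b : S5) (m h : 'X_{1..3}).

(** The exponent of [x^m u^i v^j]. *)
Definition glue m (i j : nat) : 'X_{1..5} :=
  [multinom (if (l < 3)%N then m (inord l) else if l == 3 :> nat then i else j)
     | l < 5].

Definition slice (i j : nat) a : S3 := fun m => a (glue m i j).

Lemma glue0 m i j (l : 'I_3) : glue m i j (inord l) = m l.
Proof.
have l5 : (l < 5)%N by apply: ltn_trans (ltn_ord l) _.
rewrite mnmE inordK //. by rewrite ltn_ord inord_val.
Qed.

Lemma glue3 m i j : glue m i j (inord 3) = i.
Proof. by rewrite mnmE inordK. Qed.

Lemma glue4 m i j : glue m i j (inord 4) = j.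
Proof. by rewrite mnmE inordK. Qed.

Lemma glueP (P : 'I_5 -> Prop) :
  (forall l : 'I_3, P (inord l)) -> P (inord 3) -> P (inord 4) -> forall l, P l.
Proof.
move=> P3 Pi Pj l; rewrite -(inord_val l).
case: l => -[|[|[|[|[|//]]]]] Hl //=.
- by have := P3 (@Ordinal 3 0 isT).
- by have := P3 (@Ordinal 3 1 isT).
- by have := P3 (@Ordinal 3 2 isT).
Qed.

Lemma glue_surj (m : 'X_{1..5}) : exists h,
  m = glue h (m (inord 3)) (m (inord 4)).
Proof.
exists [multinom m (inord l) | l < 3]; apply/mnmP; apply: glueP => [l||].
- by rewrite glue0 mnmE.
- by rewrite glue3.
- by rewrite glue4.
Qed.

Lemma glue_leq h m i j i' j' :
  (glue h i' j' <= glue m i j)%MM = [&& (h <= m)%MM, (i' <= i)%N & (j' <= j)%N].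
Proof.
apply/mnm_lepP/and3P => [hm|[/mnm_lepP hm ii' jj'] l].
  split; last by have := hm (inord 4); rewrite !glue4.
    by apply/mnm_lepP => l; have := hm (inord l); rewrite !glue0.
  by have := hm (inord 3); rewrite !glue3.
by move: l; apply: glueP => [l||]; rewrite ?glue0 ?glue3 ?glue4.
Qed.

Lemma glueB h m i j i' j' :
  (glue m i j - glue h i' j')%MM = glue (m - h) (i - i') (j - j').
Proof.
by apply/mnmP; apply: glueP => [l||]; rewrite mnmBE ?glue0 ?glue3 ?glue4 ?mnmBE.
Qed.

Lemma slice_mulX a h i j i' j' :
  slice i j (a * psX k (glue h i' j')) =
  if (i' <= i)%N && (j' <= j)%N then slice (i - i') (j - j') a * psX k h else 0.
Proof.
apply/funext => m; rewrite /slice ps_mulX glue_leq andbC.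
case: ifP => [/andP [-> hm]|]; first by rewrite ps_mulX hm glueB.
by case: ifP => //= _ hm; rewrite ps_mulX hm.
Qed.

Lemma in_box_glue q m i j :
  in_box q (glue m i j) = [&& in_box q m, (i < q)%N & (j < q)%N].
Proof.
apply/forallP/and3P => [mq|[/forallP mq iq jq]]; last first.
  by apply: glueP => [l||]; rewrite ?glue0 ?glue3 ?glue4.
split; last by have := mq (inord 4); rewrite glue4.
  by apply/forallP => l; have := mq (inord l); rewrite glue0.
by have := mq (inord 3); rewrite glue3.
Qed.

Lemma box0_slice q a :
  box0 q a <-> forall i j, (i < q)%N -> (j < q)%N -> box0 q (slice i j a).
Proof.
split=> [a0 i j iq jq m mq|a0 m]; first by apply: a0; rewrite in_box_glue mq iq.
have [h ->] := glue_surj m; rewrite in_box_glue => /and3P [hq iq jq].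
exact: a0.
Qed.

Lemma sliceD i j a b : slice i j (a + b) = slice i j a + slice i j b.
Proof. by []. Qed.

Lemma sliceZ i j c a : slice i j (c *: a) = c *: slice i j a.
Proof. by []. Qed.

(** [u] is the image of [v] under the inclusion of the series in [x, y, z],
    expressed by its action on slices. *)
Definition free_of_uv (u : S5) (v : S3) : Prop :=
  forall a i j, slice i j (a * u) = slice i j a * v.

Lemma free_of_uvD u u' v v' :
  free_of_uv u v -> free_of_uv u' v' -> free_of_uv (u + u') (v + v').
Proof. by move=> uv uv' a i j; rewrite !mulrDr sliceD uv uv'. Qed.

Lemma free_of_uvM u u' v v' :
  free_of_uv u v -> free_of_uv u' v' -> free_of_uv (u * u') (v * v').
Proof. by move=> uv uv' a i j; rewrite !mulrA uv' uv. Qed.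

Lemma free_of_uvX u v N : free_of_uv u v -> free_of_uv (u ^+ N) (v ^+ N).
Proof.
move=> uv; elim: N => [|N IHN]; first by move=> a i j; rewrite !mulr1.
by rewrite !exprS; apply: free_of_uvM.
Qed.

Lemma free_of_uvZ c u v : free_of_uv u v -> free_of_uv (c *: u) (c *: v).
Proof. by move=> uv a i j; rewrite -!psZAr sliceZ uv. Qed.

Lemma free_of_uv_var (l : nat) : (l < 3)%N ->
  free_of_uv (psX k U_(inord l)) (psX k U_(inord l)).
Proof.
move=> l3 a i j; have -> : U_(inord l)%MM = glue U_(inord l)%MM 0 0.
  apply/mnmP; apply: glueP => [l'||]; rewrite ?glue0 ?glue3 ?glue4 !mnm1E.
  - congr (nat_of_bool _); have l'5 := ltn_trans (ltn_ord l') (isT : 3 < 5)%N.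
    by rewrite -!val_eqE /= !inordK // (ltn_trans l3).
  - by rewrite -val_eqE /= !inordK ?(ltn_trans l3) //; case: eqP l3 => // ->.
  - by rewrite -val_eqE /= !inordK ?(ltn_trans l3) //; case: eqP l3 => // ->.
by rewrite slice_mulX !leq0n !subn0.
Qed.

Variable alpha : k.

Definition g3 : S3 := ps_of_mpoly (g_ alpha).
Definition g5 : S5 :=
  ps_of_mpoly (g_form alpha 'X_(inord 0) 'X_(inord 1) 'X_(inord 2)).
Definition uv : S5 := psX k (glue 0 1 1).
Definition G5 : S5 := ps_of_mpoly (G_ alpha).

Lemma ps_of_mpolyZ n c (p : {mpoly k[n]}) :
  ps_of_mpoly (c *: p) = c *: ps_of_mpoly p.
Proof. by apply/funext => m; rewrite /ps_of_mpoly mcoeffZ. Qed.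

Lemma g5_free : free_of_uv g5 g3.
Proof.
rewrite /g5 /g3 /g_ /g_form !(rmorphD, rmorphM, rmorphXn) /= !ps_of_mpolyZ.
rewrite !(rmorphM, rmorphXn) /=.
have [x y z] := And3 (free_of_uv_var (isT : 0 < 3)%N)
  (free_of_uv_var (isT : 1 < 3)%N) (free_of_uv_var (isT : 2 < 3)%N).
by repeat first [apply: free_of_uvD | apply: free_of_uvZ | apply: free_of_uvM
  | apply: free_of_uvX | done].
Qed.

Lemma G5E : G5 = uv + g5.
Proof.
rewrite /G5 /G_ rmorphD /= -/g5; congr (_ + _).
rewrite /uv /psX -mpolyXD; congr (ps_of_mpoly 'X_[_]); apply/mnmP.
apply: glueP => [l||]; rewrite mnmDE !mnm1E -!val_eqE /= ?glue0 ?glue3 ?glue4;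
  rewrite !inordK ?mnm0E //; case: l => -[|[|[|//]]] //.
Qed.

Lemma uvX N : uv ^+ N = psX k (glue 0 N N).
Proof.
rewrite /uv /psX -rmorphXn mpolyXn; congr (ps_of_mpoly 'X_[_]); apply/mnmP.
by apply: glueP => [l||]; rewrite mulmnE ?glue0 ?glue3 ?glue4 ?mnm0E ?mul1n.
Qed.

End Slices.

(** * The hypersurface [uv + g] *)

Section Hypersurface.
Variables (k : closedFieldType) (pchar_k : 2%N \in [pchar k]) (alpha : k).
Local Notation S3 := (powerseries 3 k).
Local Notation S5 := (powerseries 5 k).
Implicit Types (a b : S5).
Local Notation g := (g3 alpha).
Local Notation G := (G5 alpha).

Let pchar_S3 : 2%N \in [pchar S3] := ps_pchar 3 pchar_k.

Section Diagonals.
Variable Q : nat.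

(** The coefficient of [(uv)^s] in the part of [a] of [u]-degree minus
    [v]-degree equal to [c - Q]; the two truncated differences are its positive
    and negative parts. *)
Definition diag (c s : nat) a : S3 := slice (c - Q + s) (Q - c + s) a.

(** The largest [s] such that both exponents are at most [Q]. *)
Definition diag_max (c : nat) : nat := (Q - (c - Q) - (Q - c))%N.

Lemma box0_diag a : box0 Q.+1 a <->
  forall c, (c < Q + Q.+1)%N ->
    forall s, (s <= diag_max c)%N -> box0 Q.+1 (diag c s a).
Proof.
rewrite box0_slice /diag_max; split=> a0.
  by move=> c cQ s sr; apply: a0; lia.
move=> i j iQ jQ; have := a0 (i + Q - j)%N _ (minn i j) _; rewrite /diag.
have -> : (i + Q - j - Q + minn i j = i)%N by lia.
have -> : (Q - (i + Q - j) + minn i j = j)%N by lia.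
by apply; lia.
Qed.

Lemma diagD c s a b : diag c s (a + b) = diag c s a + diag c s b.
Proof. by []. Qed.

Lemma diagB c s a b : diag c s (a - b) = diag c s a - diag c s b.
Proof. by []. Qed.

Lemma diag_sum c s (I : Type) (r : seq I) (F : I -> S5) :
  diag c s (\sum_(i <- r) F i) = \sum_(i <- r) diag c s (F i).
Proof. by apply/funext => m; rewrite /diag /slice !ps_sum. Qed.

Lemma diag_exists (beta : nat -> nat -> S3) :
  exists b, forall c s, diag c s b = beta c s.
Proof.
exists (fun m => beta (m (inord 3) + Q - m (inord 4))%N
                  (minn (m (inord 3)) (m (inord 4)))
                  [multinom m (inord l) | l < 3]).
move=> c s; apply/funext => m; rewrite /diag /slice glue3 glue4.
have -> : (c - Q + s + Q - (Q - c + s) = c)%N by lia.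
have -> : minn (c - Q + s) (Q - c + s) = s by lia.
by congr (beta _ _ _); apply/mnmP => l; rewrite mnmE glue0.
Qed.

Lemma diag_mul_uv c s N a : diag c s (a * uv k ^+ N) =
  if (N <= s)%N then diag c (s - N) a else 0.
Proof.
rewrite uvX /diag slice_mulX psX0 mulr1.
have -> : ((N <= c - Q + s) && (N <= Q - c + s))%N = (N <= s)%N by lia.
by case: ifP => // Ns; rewrite !addnBA.
Qed.

Lemma diag_mul_g c s N a : diag c s (a * g5 alpha ^+ N) = diag c s a * g ^+ N.
Proof. exact/free_of_uvX/g5_free. Qed.

(** Multiplication by [G] on a diagonal is multiplication by [uv + g], where [uv]
    acts as a shift. *)
Lemma diag_mul_G c s a : diag c s (a * G) =
  (if s is s'.+1 then diag c s' a else 0) + diag c s a * g.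
Proof.
have := diag_mul_uv c s 1 a; have := diag_mul_g c s 1 a; rewrite !expr1 => ag auv.
rewrite G5E mulrDr diagD ag auv.
by case: s {ag auv} => //= s; rewrite subn1.
Qed.

(** The substitution [uv := -g] on one diagonal; the sign disappears in
    characteristic two. *)
Definition subst_uv (c : nat) a : S3 :=
  \sum_(s < (diag_max c).+1) diag c s a * g ^+ s.

Lemma subst_uvP c x a b :
  subst_uv c (x *: a + b) = x *: subst_uv c a + subst_uv c b.
Proof.
rewrite /subst_uv scaler_sumr -big_split; apply: eq_bigr => s _ /=.
by rewrite psZAl -mulrDl.
Qed.

Lemma subst_uvB c a b : subst_uv c (a - b) = subst_uv c a - subst_uv c b.
Proof.
by rewrite /subst_uv -sumrB; apply: eq_bigr => s _; rewrite diagB mulrBl.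
Qed.

Lemma subst_uv_box0 c a : (c < Q + Q.+1)%N ->
  box0 Q.+1 a -> box0 Q.+1 (subst_uv c a).
Proof.
move=> cQ /box0_diag a0; apply: big_ind => // [x y|s _]; first exact: box0D.
by rewrite mulrC; apply: box0M; apply: a0 => //; rewrite -ltnS.
Qed.

(** Each product [b s * g^(s+1)] with [s < r] occurs twice. *)
Lemma telescope_mul (b : nat -> S3) r :
  \sum_(s < r.+1) ((if (s : nat) is s'.+1 then b s' else 0) + b s * g) * g ^+ s
  = b r * g ^+ r.+1.
Proof.
elim: r => [|r IHr].
  by rewrite big_ord1 add0r expr0 expr1 mulr1.
rewrite big_ord_recr /= IHr mulrDl addrA (addrr_pchar2 pchar_S3) add0r.
by rewrite -mulrA -exprS.
Qed.

Lemma subst_uv_mulG c a :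
  subst_uv c (a * G) = diag c (diag_max c) a * g ^+ (diag_max c).+1.
Proof.
rewrite -(telescope_mul (fun s => diag c s a)).
by apply: eq_bigr => s _; rewrite diag_mul_G.
Qed.

(** If the substitution sends [a] into [(g^(r+1))] on each diagonal, where [r] is
    [diag_max c], then [a = b * G] can be solved for [b] from the highest power of
    [uv] downwards; the hypothesis is the equation left at the lowest power. *)
Lemma box_ideal_G a : box_ideal Q.+1 G a <->
  forall c : 'I_(Q + Q.+1), box_ideal Q.+1 (g ^+ (diag_max c).+1) (subst_uv c a).
Proof.
split=> [[b ab] c|aG].
  exists (diag c (diag_max c) b); rewrite -subst_uv_mulG -subst_uvB.
  exact: subst_uv_box0.
have /choice [h hE] c : exists h, (c < Q + Q.+1)%N ->
    box0 Q.+1 (subst_uv c a - h * g ^+ (diag_max c).+1).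
  case: (ltnP c (Q + Q.+1)) => [cQ|_]; last by exists 0.
  by have [h] := aG (Ordinal cQ); exists h.
(* down c u is the coefficient of (uv)^(diag_max c - u) in the solution *)
pose down c := fix F u := if u is u'.+1
  then diag c (diag_max c - u') a + F u' * g else h c.
have [b bE] := diag_exists (fun c s => down c (diag_max c - s)%N).
have ab_pos c s : (s < diag_max c)%N -> diag c s.+1 (a - b * G) = 0.
  move=> sr; rewrite diagB diag_mul_G.
  have -> : diag c s b = diag c s.+1 a + diag c s.+1 b * g.
    rewrite !bE; have -> : (diag_max c - s = (diag_max c - s.+1).+1)%N by lia.
    by rewrite /= subKn.
  by rewrite -addrA (addrr_pchar2 pchar_S3) addr0 subrr.
exists b; apply/box0_diag => c cQ [_|s sr]; last by rewrite ab_pos.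
have -> : diag c 0 (a - b * G) = subst_uv c (a - b * G).
  rewrite /subst_uv big_ord_recl mulr1 big1 ?addr0 // => s _.
  by rewrite ab_pos ?mul0r.
by rewrite subst_uvB subst_uv_mulG bE subnn; apply: hE.
Qed.

Lemma subst_uv_surj (y : 'I_(Q + Q.+1) -> S3) :
  exists a, forall c : 'I_(Q + Q.+1), subst_uv c a = y c.
Proof.
have [a aE] := diag_exists (fun c s =>
  if s is 0%N then (if insub c is Some c' then y c' else 0) else 0).
exists a => c; rewrite /subst_uv big_ord_recl big1 => [|s _].
  by rewrite aE valK mulr1 addr0.
by rewrite aE mul0r.
Qed.

End Diagonals.

(** All binomial coefficients [binomial (2^e - 1) i] are odd. *)
Lemma exprD_pred (A : comNzRingType) (pchar_A : 2%N \in [pchar A]) (t u : A) e :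
  (t + u) ^+ (2 ^ e).-1 = \sum_(i < 2 ^ e) t ^+ i * u ^+ ((2 ^ e).-1 - i).
Proof.
elim: e => [|e IHe]; first by rewrite expn0 big_ord1 !mulr1.
rewrite expnS mul2n -addnn.
have -> : (2 ^ e + 2 ^ e).-1 = (2 ^ e + (2 ^ e).-1)%N by have := q_gt0 e; lia.
rewrite exprD (exprD_pchar pchar_A) IHe mulrDl addrC big_split_ord !mulr_sumr.
have q0 := q_gt0 e; congr (_ + _); apply: eq_bigr => i _ /=.
  rewrite mulrCA -exprD; congr (_ * _ ^+ _); have := ltn_ord i; lia.
rewrite mulrA -exprD; congr (_ * _ ^+ _); lia.
Qed.

Section Truncated.
Variables (e Q : nat).
Hypothesis qE : (2 ^ e)%N = Q.+1.

Lemma g_coef0 : g 0%MM = 0.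
Proof.
have X0 (i : 'I_3) : mcoeff 0%MM ('X_i : {mpoly k[3]}) = 0.
  by rewrite mcoeffX mnm1_eq0.
rewrite /g3 /ps_of_mpoly /g_ /g_form.
rewrite !(mcoeffD, mcoeffZ, rmorphM, rmorphD, rmorphXn) /= !X0.
by rewrite !(expr0n, mulr0, mul0r, addr0).
Qed.

Lemma box0_gq : box0 Q.+1 (g ^+ Q.+1).
Proof. by rewrite -qE; apply/(box0_exp pchar_k)/g_coef0. Qed.

Lemma diag_mul_Gq c s a : diag Q c s (a * G ^+ Q.+1) =
  (if (Q.+1 <= s)%N then diag Q c (s - Q.+1) a else 0) + diag Q c s a * g ^+ Q.+1.
Proof.
have -> : G ^+ Q.+1 = uv k ^+ Q.+1 + g5 alpha ^+ Q.+1.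
  by rewrite G5E -qE (exprD_pchar (ps_pchar 5 pchar_k)).
rewrite mulrDr diagD; congr (_ + _); first exact: diag_mul_uv.
exact: diag_mul_g.
Qed.

(** On each diagonal the coefficient of the highest power of [uv] in [a * G^(q-1)]
    determines the others, because [G * G^(q-1) = G^q] vanishes there; that
    coefficient is the substitution [uv := g] in [a], times a power of [g]. *)
Lemma ann_Gq a : box0 Q.+1 (a * G ^+ Q) <->
  forall c : 'I_(Q + Q.+1),
    box0 Q.+1 (subst_uv Q c a * g ^+ (c - Q + (Q - c))).
Proof.
have topE c : (c < Q + Q.+1)%N -> diag Q c (diag_max Q c) (a * G ^+ Q) =
    subst_uv Q c a * g ^+ (c - Q + (Q - c)).
  move=> cQ; have max_le : (diag_max Q c < Q.+1)%N by rewrite /diag_max; lia.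
  have := exprD_pred (ps_pchar 5 pchar_k) (uv k) (g5 alpha) e.
  rewrite -G5E qE /= => ->; rewrite mulr_sumr diag_sum /subst_uv mulr_suml.
  rewrite [RHS](reindex_inj rev_ord_inj) /=.
  rewrite (big_ord_widen _ (fun i => diag Q c ((diag_max Q c).+1 - i.+1) a *
    g ^+ ((diag_max Q c).+1 - i.+1) * g ^+ (c - Q + (Q - c))) max_le) [RHS]big_mkcond.
  apply: eq_bigr => i _; rewrite mulrA diag_mul_g diag_mul_uv ltnS subSS.
  case: ifP => [ir|_]; last by rewrite mul0r.
  by rewrite -mulrA -exprD; congr (_ * _ ^+ _); move: ir; rewrite /diag_max; lia.
rewrite box0_diag; split=> [a0 c|a0 c cQ s]; first by rewrite -topE //; apply: a0.
have {}a0 : box0 Q.+1 (diag Q c (diag_max Q c) (a * G ^+ Q)).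
  by rewrite topE //; apply: (a0 (Ordinal cQ)).
move=> sr; rewrite -(subKn sr); move: (_ - s)%N (leq_subr s (diag_max Q c)) => u.
elim: u => [|u IHu] ur; first by rewrite subn0.
have := diag_mul_G Q c (diag_max Q c - u) (a * G ^+ Q).
have -> : (diag_max Q c - u = (diag_max Q c - u.+1).+1)%N by lia.
move=> /eqP; rewrite -subr_eq => /eqP <-; apply: box0B; last first.
  by rewrite mulrC; apply/box0M; rewrite -subSn // subSS; apply/IHu/ltnW.
rewrite -mulrA -exprSr diag_mul_Gq ifN ?add0r; last first.
  have max_le : (diag_max Q c <= Q)%N by rewrite /diag_max; lia.
  by rewrite -ltnNge; move: ur max_le; clear; lia.
exact/box0M/box0_gq.
Qed.

End Truncated.

(** * Dimensions attached to the hypersurface *)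

(** Two diagonals lie at each positive distance from the middle one. *)
Lemma sum_diag Q (F : nat -> nat) :
  (\sum_(c < Q + Q.+1) F (c - Q + (Q - c)) =
   \sum_(i < Q.+1) F i + \sum_(i < Q) F i.+1)%N.
Proof.
rewrite big_split_ord /= addnC; congr (_ + _)%N.
  by apply: eq_bigr => i _ /=; congr F; lia.
rewrite [RHS](reindex_inj rev_ord_inj); apply: eq_bigr => i _ /=; congr F.
have := ltn_ord i; lia.
Qed.

(** The diagonal at distance [d] from the middle one contributes the dimension of
    the truncated ring in [x, y, z] modulo [g^(q - d)]. *)
Lemma e_G e : e_ e (G_ alpha) =
  (\sum_(j < 2 ^ e) (e_ e (g_ alpha ^+ j) + e_ e (g_ alpha ^+ j.+1)))%N.
Proof.
have [Q qE] : exists Q, (2 ^ e)%N = Q.+1.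
  by exists (2 ^ e).-1; rewrite prednK // q_gt0.
pose D j := e_ e (g_ alpha ^+ j).
have -> : e_ e (G_ alpha) = (\sum_(c < Q + Q.+1) D (diag_max Q c).+1)%N.
  apply: codim_e; apply: (@codim_family _ _ _ idfun _
    (fun c : 'I_(Q + Q.+1) => subst_uv Q c) _
    (fun c => box_ideal (2 ^ e) (g ^+ (diag_max Q c).+1))).
  - by move=> x; exists x.
  - by move=> c; rewrite /D /g3 -rmorphXn; apply: codim_box_ideal.
  - by move=> c x a b; apply: subst_uvP.
  - by move=> a; rewrite qE; apply: box_ideal_G.
  - move=> y; have [a aE] := subst_uv_surj y.
    by exists a => c; rewrite aE subrr; apply: box_ideal0.
have -> : (\sum_(c < Q + Q.+1) D (diag_max Q c).+1 =
    \sum_(c < Q + Q.+1) D (Q.+1 - (c - Q + (Q - c))))%N.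
  by apply: eq_bigr => c _; congr D; have := ltn_ord c; rewrite /diag_max; lia.
rewrite (sum_diag Q (fun i => D (Q.+1 - i)%N)) qE big_split addnC.
congr (_ + _)%N.
  rewrite [RHS]big_ord_recl /= {1}/D expr0 e_one add0n.
  rewrite [LHS](reindex_inj rev_ord_inj); apply: eq_bigr => i _ /=.
  by congr D; rewrite /bump; have := ltn_ord i; lia.
rewrite [LHS](reindex_inj rev_ord_inj); apply: eq_bigr => i _ /=.
by congr D; have := ltn_ord i; lia.
Qed.

Lemma e_G_leq e : (e_ e (G_ alpha) <= 2 * (2 ^ e) ^ 4)%N.
Proof.
rewrite e_G; have -> : (2 * (2 ^ e) ^ 4 = \sum_(j < 2 ^ e) (2 * (2 ^ e) ^ 3))%N.
  by rewrite sum_nat_const card_ord mulnCA -expnS.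
by apply: leq_sum => j _; rewrite mul2n -addnn leq_add // e_leq.
Qed.

(** By [ann_Gq] the diagonal at distance [d] contributes the rank of [g^d], which
    is [q^3 - e_e(g^d)]; summing over the diagonals complements [e_G]. *)
Lemma codim_ann_Gq e :
  codim [set a | box0 (2 ^ e) (a * G ^+ (2 ^ e).-1)]
        (2 * (2 ^ e) ^ 4 - e_ e (G_ alpha)).
Proof.
have [Q qE] : exists Q, (2 ^ e)%N = Q.+1.
  by exists (2 ^ e).-1; rewrite prednK // q_gt0.
pose F j := ((2 ^ e) ^ 3 - e_ e (g_ alpha ^+ j))%N.
have -> : (2 * (2 ^ e) ^ 4 - e_ e (G_ alpha) =
    \sum_(c < Q + Q.+1) F (c - Q + (Q - c)))%N.
  rewrite (sum_diag Q F).
  have FQ : F Q.+1 = 0%N.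
    rewrite /F e_box0 ?subnn // rmorphXn qE; exact: box0_gq qE.
  have <- : (\sum_(i < Q.+1) F i.+1 = \sum_(i < Q) F i.+1)%N.
    by rewrite big_ord_recr /= FQ addn0.
  move: (e_G_leq e); rewrite -big_split /= e_G qE => e_leq_G.
  apply: (@addIn (\sum_(j < Q.+1) (e_ e (g_ alpha ^+ j) + e_ e (g_ alpha ^+ j.+1)))).
  rewrite subnK //.
  rewrite -big_split /= (eq_bigr (fun=> 2 * Q.+1 ^ 3)%N) => [|j _].
    by rewrite sum_nat_const card_ord mulnCA -expnS.
  rewrite /F qE; have := e_leq e (g_ alpha ^+ j).
  have := e_leq e (g_ alpha ^+ j.+1); rewrite qE; lia.
apply: (@codim_family _ _ _ idfun _
    (fun c : 'I_(Q + Q.+1) => subst_uv Q c) _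
  (fun c => [set a | box0 (2 ^ e) (a * g ^+ (c - Q + (Q - c)))])).
- by move=> x; exists x.
- by move=> c; rewrite /F /g3 -rmorphXn; apply: codim_ann.
- by move=> c x a b; apply: subst_uvP.
- by move=> a; rewrite qE /=; apply: (ann_Gq qE).
- move=> y; have [a aE] := subst_uv_surj y.
  exists a => c; rewrite /= aE subrr mul0r; exact: box0_0.
Qed.

End Hypersurface.
(** * Lengths as dimensions *)

Lemma chain_mono (A : comNzRingType) (I : set A) N J : ideal_chain I N J ->
  forall i j, (i <= j)%N -> (j <= N)%N -> J i `<=` J j.
Proof.
move=> [_ _ _ J_lt] i j /subnKC <-; elim: (j - i)%N => [|u IHu] uN.
  by rewrite addn0.
move: uN; rewrite addnS => uN.
by apply: (subset_trans (IHu (ltnW uN))); have [] := J_lt _ uN.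
Qed.

Lemma ideal_sum (A : comNzRingType) (J : set A) (T : Type) (r : seq T)
    (P : pred T) (F : T -> A) :
  is_ideal J -> (forall i, P i -> J (F i)) -> J (\sum_(i <- r | P i) F i).
Proof. by move=> [J0 JD _] JF; apply: big_ind. Qed.

Lemma ideal_subr (A : comNzRingType) (J : set A) x y :
  is_ideal J -> J (x + y) -> J y -> J x.
Proof.
move=> [_ JD JM] Jxy Jy; rewrite -(addrK y x) -mulN1r.
by apply: (JD) => //; apply: JM.
Qed.

(** Ideals of the image correspond to ideals above the kernel. *)
Lemma length_transport (A B : comNzRingType) (pi : {rmorphism A -> B})
    (I : set B) N :
  (forall y, exists x, pi x = y) ->
  has_length_quot [set x | I (pi x)] N -> has_length_quot I N.
Proof.
move=> pi_surj [[J J_chain] J_max]; split; last first.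
  move=> m J' [J0 Jm Jid Jlt]; apply: (J_max m (fun i => [set x | J' i (pi x)])).
  split.
  - by rewrite J0.
  - by rewrite Jm.
  - move=> i /Jid [Ji0 JiD JiM]; split=> [|x y|a x] /=.
    + by rewrite rmorph0.
    + by rewrite rmorphD; apply: JiD.
    + by rewrite rmorphM; apply: JiM.
  - move=> i /Jlt [JS Jn]; split=> [x /= /JS //|S].
    by apply: Jn => y; have [x <-] := pi_surj y; apply: S.
have [J0 Jm Jid Jlt] := J_chain.
exists (fun i => pi @` J i); split.
- rewrite J0; apply/seteqP; split=> [_ [x Ix <-] //|y Iy].
  by have [x xy] := pi_surj y; exists x; rewrite //= xy.
- rewrite Jm; apply/seteqP; split=> // y _.
  by have [x xy] := pi_surj y; exists x.
- move=> i /Jid [Ji0 JiD JiM]; split.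
  + by exists 0; rewrite ?rmorph0.
  + move=> _ _ [x Jx <-] [y Jy <-]; exists (x + y); rewrite ?rmorphD //.
    exact: JiD.
  + move=> b _ [x Jx <-]; have [a <-] := pi_surj b.
    by exists (a * x); rewrite ?rmorphM //; apply: JiM.
- move=> i iN; have [JS Jn] := Jlt i iN; split=> [_ [x Jx <-]|S].
    by exists x => //; apply: JS.
  apply: Jn => x Jx; have [|y Jy xy] := S (pi x); first by exists x.
  have Ji : is_ideal (J i) by apply/Jid/ltnW.
  rewrite -(subrK y x); have [_ JD _] := Ji; apply: JD => //.
  apply: (chain_mono J_chain (leq0n i) (ltnW iN)); rewrite J0 /=.
  rewrite rmorphB xy subrr; have [] : is_ideal (J 0%N) by apply: Jid.
  by rewrite J0 /= rmorph0.
Qed.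

Section Length.
Variables (n : nat) (k : fieldType).
Local Notation S := (powerseries n k).

Lemma codim_setT (V : lmodType k) : codim (setT : set V) 0.
Proof.
pose z : {linear V -> 'rV[k]_0} := \0; exists z; split=> [v|y].
  by split=> // _; rewrite [LHS]thinmx0.
by exists 0; rewrite [LHS]thinmx0 [RHS]thinmx0.
Qed.

Lemma codim0 (V : lmodType k) (W : set V) : codim W 0 -> W = setT.
Proof.
move=> [phi [phiW _]]; apply/seteqP; split=> // v _.
by apply/phiW; rewrite [LHS]thinmx0.
Qed.

Lemma codim_add_line (V : lmodType k) (W : set V) (x : V) N :
  codim W N.+1 -> ~ W x -> codim [set v | exists c : k, W (v - c *: x)] N.
Proof.
move=> [phi [phiW phi_surj]] Wx.
have phix : phi x != 0 by apply/eqP => /phiW.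
have -> : [set v | exists c : k, W (v - c *: x)] =
          [set v | phi v *m cokermx (phi x) = 0].
  apply/seteqP; split=> v /=.
    move=> [c /phiW]; rewrite linearB linearZ => /eqP; rewrite subr_eq0.
    by move=> /eqP ->; rewrite -scalemxAl mulmx_coker scaler0.
  move=> /eqP; rewrite -submxE => /sub_rVP [c vE]; exists c; apply/phiW.
  by rewrite linearB linearZ /= vE subrr.
have rk : \rank (cokermx (phi x)) = N by rewrite mxrank_coker rank_rV phix subn1.
by have := codim_rank (cokermx (phi x)) phi_surj; rewrite rk.
Qed.

(** Elements chosen one in each step of a chain are independent modulo [I]. *)
Lemma chain_leq (I : set S) N m J :
  codim I N -> ideal_chain I m J -> (m <= N)%N.
Proof.
move=> IN J_chain; have [J0 _ Jid Jlt] := J_chain.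
have step (i : 'I_m) : exists x, J i.+1 x /\ ~ J i x.
  have [_ Jn] := Jlt i (ltn_ord i); apply: contra_notP Jn => none x Jx.
  by apply: contra_notP none => Jix; exists x.
have [x xE] := choice step.
apply: (codim_indep_leq IN (b := x)) => c Ic i; apply/eqP; apply: contraT => ci.
have [i0 ci0 imax] := @arg_maxnP _ i (fun i => c i != 0) (fun i => i : nat) ci.
have [] := xE i0 => _; case; have Ji0 := Jid i0 (ltnW (ltn_ord i0)).
have [_ _ JM] := Ji0.
rewrite -[x i0]scale1r -(mulVf ci0) -scalerA -psCM; apply: (JM).
apply: (@ideal_subr _ _ _ (\sum_(i | i != i0) c i *: x i)) => //.
  apply: (chain_mono J_chain (leq0n i0) (ltnW (ltn_ord i0))).
  by move: Ic; rewrite J0 (bigD1 i0).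
apply: ideal_sum => // j ji; have [->|cj] := eqVneq (c j) 0.
  by rewrite scale0r; have [] := Ji0.
rewrite -psCM; apply: JM; have ji0 : (j < i0)%N.
  rewrite ltn_neqAle [X in _ && X](imax j cj) andbT.
  by apply: contra_neq ji => /val_inj.
by apply: (chain_mono J_chain ji0 (ltnW (ltn_ord i0))); have [] := xE j.
Qed.

(** A monomial of maximal degree outside [I] is killed by every variable modulo
    [I], so that adjoining it raises [I] by one dimension. *)
Lemma socle_mon q (I : set S) : is_ideal I -> box0 q `<=` I -> I <> setT ->
  exists x, ~ I x /\ forall i, I (psX k U_(i) * x).
Proof.
move=> Iid boxI IT; have [I0 ID IM] := Iid.
pose P d := `[< exists m, mdeg m = d /\ ~ I (psX k m) >].
have exP : exists d, P d.
  exists 0%N; apply/asboolP; exists 0%MM; rewrite mdeg0 psX0; split=> // I1.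
  by apply: IT; apply/seteqP; split=> // a _; rewrite -(mulr1 a); apply: IM.
have P_max d : P d -> (d <= (n * q).+1)%N.
  move=> /asboolP [m [<- Im]]; apply: ltnW; apply: in_box_mdeg.
  by apply: contra_notT Im => mq; apply/boxI/box0X.
have [d /asboolP [m [md Im]] d_max] := ex_maxnP exP P_max.
exists (psX k m); split=> // i; rewrite -psXD; apply: contrapT => Im'.
have : P d.+1.
  by apply/asboolP; exists (U_(i) + m)%MM; rewrite mdegD mdeg1 md.
by move=> /d_max; rewrite ltnn.
Qed.

(** The residue field of the power series ring is [k], so ideals can be enlarged
    one dimension at a time. *)
Lemma length_of_codim q (I : set S) N :
  is_ideal I -> box0 q `<=` I -> codim I N -> has_length_quot I N.
Proof.
move=> Iid boxI IN; split; last by move=> m J; apply: chain_leq.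
elim: N I Iid boxI IN => [|N IHN] I Iid boxI IN.
  by exists (fun=> I); split=> //; apply: codim0.
have IT : I <> setT.
  by move=> IT; move: IN; rewrite IT => /(codim_uniq (@codim_setT S)).
have [x [Ix xI]] := socle_mon Iid boxI IT; have [I0 ID IM] := Iid.
pose I' := [set a | exists c : k, I (a - c *: x)].
have II' : I `<=` I' by move=> a Ia; exists 0; rewrite scale0r subr0.
have I'id : is_ideal I'.
  split=> [|a b [c ac] [d bd]|a b [c bc]]; first exact: II'.
    by exists (c + d); rewrite scalerDl opprD addrACA; apply: ID.
  have [t tE] := ps_coef0_gen a; exists (a 0%MM * c).
  have ax : a * x = a 0%MM *: x + \sum_i t i * (psX k U_(i) * x).
    rewrite {1}tE mulrDl psCM mulr_suml; congr (_ + _).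
    by apply: eq_bigr => i _; rewrite mulrA.
  have -> : a * b = a * (b - c *: x) + c *: (a * x).
    by rewrite mulrBr -psZAr subrK.
  rewrite ax scalerDr scalerA (mulrC c) addrCA addrAC subrr add0r.
  apply: ID; first exact: IM.
  by rewrite -psCM; apply: (IM); apply: ideal_sum => // i _; apply: IM.
have [|J' [J0 JN Jid Jlt]] := IHN I' I'id (subset_trans boxI II').
  exact: codim_add_line.
exists (fun i => if i is j.+1 then J' j else I); split=> //.
- by case=> // i; apply: Jid.
- case=> [_|i]; last exact: Jlt.
  rewrite J0; split=> // S'; apply: Ix; apply: S'; exists 1.
  by rewrite scale1r subrr.
Qed.

End Length.

(** * The hypersurface ring *)

Section PrincipalQuotientTheory.
Variables (A : comNzRingType) (f : A) (f_nonunit : nonunits f).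

Definition proj : {rmorphism A -> principal_quot f_nonunit} :=
  \pi_({ideal_quot (principal_pred f_nonunit)})%qT.

Lemma proj_surj y : exists x, proj x = y.
Proof. by exists (repr y); apply: reprK. Qed.

Lemma proj_eq x y : proj x = proj y <-> exists b, x - y = b * f.
Proof.
rewrite -ideal_gen1E; split=> [/eqP|xy].
  by rewrite -Quotient.idealrBE => /asboolP.
by apply/eqP; rewrite -Quotient.idealrBE; apply/asboolP.
Qed.

End PrincipalQuotientTheory.

Section HypersurfaceRing.
Variables (k : closedFieldType) (pchar_k : 2%N \in [pchar k]) (alpha : k).
Local Notation S := (powerseries 5 k).
Local Notation R := (R_ alpha).
Local Notation G := (G5 alpha).
Implicit Types (a b s x : S).

Let pchar_S : 2%N \in [pchar S] := ps_pchar 5 pchar_k.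

Definition to_R : {rmorphism S -> R} := proj (@G_nonunit k alpha).

Lemma to_R_surj y : exists x, to_R x = y.
Proof. exact: proj_surj. Qed.

Lemma to_R_eq x y : to_R x = to_R y <-> exists b, x - y = b * G.
Proof. exact: proj_eq. Qed.

Lemma to_RG : to_R G = 0.
Proof. by rewrite -(rmorph0 to_R); apply/to_R_eq; exists 1; rewrite subr0 mul1r. Qed.

Lemma G_coef0 : G 0%MM = 0.
Proof. exact/ps_nonunitP/(@G_nonunit k alpha). Qed.

Lemma nonunits_R s : nonunits (to_R s) <-> s 0%MM = 0.
Proof.
split=> [s_nonunit|s0 [y]].
  apply/ps_nonunitP => -[b bs]; apply: s_nonunit; exists (to_R b).
  by rewrite -rmorphM bs rmorph1.
have [t <-] := to_R_surj y.
rewrite -rmorphM -(rmorph1 to_R) => /to_R_eq [b /(congr1 (fun c : S => c 0%MM))].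
rewrite psB !ps_mul0 s0 G_coef0 !mulr0 ps1 eqxx sub0r => /eqP.
by rewrite oppr_eq0 oner_eq0.
Qed.

(** A solution of [x * G = 0] is divisible by every power of [g] on each
    diagonal. *)
Lemma mulG_eq0 x : x * G = 0 -> x = 0.
Proof.
move=> xG; have step i j : slice i j x = slice i.+1 j.+1 x * g3 alpha.
  have := congr1 (slice i.+1 j.+1) xG; rewrite G5E mulrDr sliceD slice_mulX.
  rewrite /= psX0 mulr1 !subn1 g5_free => /eqP.
  by rewrite addr_eq0 (oppr_pchar2 (ps_pchar 3 pchar_k)) => /eqP.
have steps N i j : slice i j x = slice (i + N) (j + N) x * g3 alpha ^+ N.
  elim: N i j => [|N IHN] i j; first by rewrite !addn0 mulr1.
  by rewrite IHN step -!addnS -mulrA -exprS.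
apply/funext => m; have [h ->] := glue_surj m.
rewrite -[LHS]/(slice _ _ x h) (steps (mdeg h).+1).
apply: ps_mul_eq0 => h1 h2 hE; rewrite (ps_exp_order (g_coef0 alpha)) ?mulr0 //.
by rewrite ltnS hE mdegD leq_addl.
Qed.

Section Exponent.
Variable e : nat.
Local Notation q := (2 ^ e)%N.

(** The [q]-th power of a series without constant term lies in [box0 q]. *)
Lemma frobenius_power_R :
  [set s | frobenius_power q (@nonunits R) (to_R s)] = box_ideal q G.
Proof.
have [F0 FD FM] : is_ideal (frobenius_power q (@nonunits R)).
  exact: ideal_gen_is_ideal.
apply/seteqP; split=> s /=.
  move=> /(_ (to_R @` box_ideal q G)) [].
  - have [B0 BD BM] := box_ideal_ideal q G; split=> [|_ _ [x Bx <-] [y By <-]|b _ [x Bx <-]].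
    + by exists 0; rewrite ?rmorph0.
    + by exists (x + y); rewrite ?rmorphD //; apply: BD.
    + have [a <-] := to_R_surj b; exists (a * x); rewrite ?rmorphM //.
      exact: BM.
  - move=> _ [y y_nonunit <-]; have [x xy] := to_R_surj y.
    exists (x ^+ q); last by rewrite rmorphXn xy.
    apply/box_ideal0/(box0_exp pchar_k)/nonunits_R; by rewrite xy.
  - move=> x [b xb] /to_R_eq [c xs]; exists (b - c).
    have -> : s - (b - c) * G = x - b * G by rewrite mulrBl -xs; ring.
    exact: xb.
move=> [b /box0_gen [t sE]].
have -> : s = b * G + \sum_i t i * psX k U_(i) ^+ q by rewrite -sE addrC subrK.
rewrite rmorphD rmorphM to_RG mulr0 add0r rmorph_sum /=.
apply: big_ind => [|x y|i _]; [exact: F0|exact: FD|].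
rewrite rmorphM; apply: FM => I _; apply; exists (to_R (psX k U_(i))).
  by apply/nonunits_R; rewrite psXE mnm1_eq0.
by rewrite rmorphXn.
Qed.

Lemma length_HK : has_length_quot (frobenius_power q (@nonunits R)) (e_ e (G_ alpha)).
Proof.
apply: (length_transport (pi := to_R) to_R_surj); rewrite frobenius_power_R.
apply: (@length_of_codim _ _ q); first exact: box_ideal_ideal.
  exact: box_ideal0.
exact: codim_box_ideal.
Qed.

(** * The Fedder criterion *)

Definition top_mon : 'X_{1..5} := [multinom q.-1 | i < 5].

Lemma top_mon_box : in_box q top_mon.
Proof. by apply/forallP => i; rewrite mnmE prednK // q_gt0. Qed.

Lemma cartier_top (t : box_index 5 e) x :
  cartier e top_mon (psX k (top_mon - box_mon t) * x) = cartier e (box_mon t) x.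
Proof.
have t_le i : (box_mon t i <= q.-1)%N.
  by rewrite -ltnS prednK ?q_gt0 //; apply: (forallP (box_monP t)).
apply/funext => m; rewrite /cartier mulrC ps_mulX ifT.
  congr (qroot e (x _)); apply/mnmP => i; have := t_le i.
  by rewrite !(mnmBE, mnmDE) [top_mon i]mnmE; lia.
by apply/mnm_lepP => i; rewrite !(mnmBE, mnmDE); lia.
Qed.

Variable (pchar_R : 2%N \in [pchar R]).

(** If some coordinate of [s * G^(q-1)] is a unit, then that coordinate of
    [x * G^(q-1)], divided by this unit, is a splitting; it is well defined on [R]
    because the coordinates of a multiple of [G^q] are multiples of [G]. *)
Lemma split_of_cartier s : ~ box0 q (s * G ^+ q.-1) ->
  root_map_splits pchar_R e (to_R s).
Proof.
move=> sG; have [t tG] : exists t : box_index 5 e,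
    cartier e (box_mon t) (s * G ^+ q.-1) 0%MM != 0.
  apply: contra_notP sG => none; apply/(box0_cartier pchar_k e _) => t; apply/eqP.
  by apply: contra_notT none; exists t.
have [u uE] := ps_unit tG.
pose rep (y : R) := sval (cid (to_R_surj y)).
have repK y : to_R (rep y) = y by apply: (svalP (cid (to_R_surj y))).
pose kappa x := cartier e (box_mon t) (x * G ^+ q.-1).
pose psi (y : pth_roots e pchar_R) : R^o := to_R (u * kappa (rep y)).
have psiE x : psi (to_R x) = to_R (u * kappa x).
  have /to_R_eq [b xb] : to_R (rep (to_R x)) = to_R x by rewrite repK.
  apply/to_R_eq; exists (u * cartier e (box_mon t) b).
  rewrite -mulrBr /kappa -(cartierB pchar_k) -mulrBl xb -mulrA -exprS.
  rewrite prednK ?q_gt0 // [b * _]mulrC (cartierM pchar_k) ?box_monP //.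
  by rewrite -mulrA [G * _]mulrC.
have psiL : linear psi.
  move=> a y z; have [a' <-] := to_R_surj a.
  have [y' yE] := to_R_surj y; have [z' zE] := to_R_surj z.
  have -> : to_R a' *: y + z = to_R (a' ^+ q * y' + z').
    by rewrite rmorphD rmorphM rmorphXn yE zE.
  rewrite psiE -yE -zE !psiE /kappa mulrDl (cartierD pchar_k) -mulrA.
  rewrite (cartierM pchar_k) ?box_monP // mulrDr rmorphD; congr (_ + _).
  by rewrite mulrCA rmorphM.
pose psi' : {linear pth_roots e pchar_R -> R^o} :=
  HB.pack psi (GRing.isLinear.Build R (pth_roots e pchar_R) R^o _ psi psiL).
exists psi' => a; have [a' <-] := to_R_surj a; rewrite /= /pth_root.
have -> : to_R a' *: (to_R s : pth_roots e pchar_R) = to_R (a' ^+ q * s).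
  by rewrite rmorphM rmorphXn.
rewrite psiE /kappa -mulrA (cartierM pchar_k) ?box_monP // mulrCA.
by rewrite uE mulr1.
Qed.

(** A linear map on [R^(1/q)] lifts to the power series ring, where it is [x |->
    kappa (w * x)] for the coordinate [kappa] of the top monomial.  Since it
    preserves the ideal of [G], the multiplier [w] is divisible by
    [G^(q - 1)]. *)
Lemma cartier_of_split s : box0 q (s * G ^+ q.-1) ->
  ~ root_map_splits pchar_R e (to_R s).
Proof.
move=> sG [psi psiP]; pose kappa x := cartier e top_mon x.
have [c cE] := choice (fun t : box_index 5 e =>
  to_R_surj (psi (to_R (psX k (box_mon t)) : pth_roots e pchar_R))).
have [w psiE] : exists w, forall x,
    psi (to_R x : pth_roots e pchar_R) = to_R (kappa (w * x)).
  exists (\sum_(t : box_index 5 e) c t ^+ q * psX k (top_mon - box_mon t)) => x.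
  rewrite /kappa mulr_suml (cartier_sum pchar_k) rmorph_sum /=.
  rewrite {1}(cartier_decomp pchar_k e x) rmorph_sum.
  transitivity (\sum_(t : box_index 5 e) psi (to_R (cartier e (box_mon t) x) *:
    (to_R (psX k (box_mon t)) : pth_roots e pchar_R))).
    rewrite -linear_sum; congr (psi _); apply: eq_bigr => t _.
    by rewrite rmorphM rmorphXn.
  apply: eq_bigr => t _; rewrite linearZ /= -mulrA (cartierM pchar_k) ?top_mon_box //.
  by rewrite cartier_top rmorphM cE mulrC.
have wG (t : box_index 5 e) : exists y, cartier e (box_mon t) (w * G) = y * G.
  have : to_R (kappa (w * (G * psX k (top_mon - box_mon t)))) = to_R 0.
    by rewrite -psiE rmorphM to_RG mul0r linear0 rmorph0.
  move=> /to_R_eq [y yE]; exists y; rewrite -yE subr0 /kappa.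
  have -> : w * (G * psX k (top_mon - box_mon t)) =
            psX k (top_mon - box_mon t) * (w * G) by rewrite mulrA mulrC.
  by rewrite cartier_top.
have [y yE] := choice wG.
pose w' := \sum_(t : box_index 5 e) y t ^+ q * psX k (box_mon t).
have wE : w = w' * G ^+ q.-1.
  apply/eqP; rewrite -subr_eq0; apply/eqP/mulG_eq0.
  rewrite mulrBl -mulrA -exprSr prednK ?q_gt0 //.
  rewrite [w * G](cartier_decomp pchar_k e) /w' mulr_suml -sumrB big1 // => t _.
  by rewrite yE exprMn mulrAC subrr.
have : nonunits (to_R (kappa (w * s))).
  apply/nonunits_R; have [t tE] := in_boxP top_mon_box.
  rewrite /kappa tE; apply: ((box0_cartier pchar_k e _).1 _).
  by rewrite wE -mulrA [_ * s]mulrC; apply: box0M.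
apply; exists 1; rewrite -psiE mul1r -[RHS](psiP 1) scale1r //.
Qed.

Lemma nonsplit_R :
  [set s | nonsplit_ideal pchar_R e (to_R s)] = [set s | box0 q (s * G ^+ q.-1)].
Proof.
apply/seteqP; split=> s /=; last exact: cartier_of_split.
by apply: contra_notP; apply: split_of_cartier.
Qed.

Lemma length_Fsig : has_length_quot (nonsplit_ideal pchar_R e)
  (2 * q ^ 4 - e_ e (G_ alpha)).
Proof.
apply: (length_transport (pi := to_R) to_R_surj); rewrite nonsplit_R.
apply: (@length_of_codim _ _ q); last exact: codim_ann_Gq.
  split=> [|a b|a b] /=; first by rewrite mul0r; apply: box0_0.
    by rewrite mulrDl; apply: box0D.
  by rewrite -mulrA; apply: box0M.
by move=> a a0; rewrite /= mulrC; apply: box0M.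
Qed.

End Exponent.
End HypersurfaceRing.

(** * Degrees over the prime field *)

Section FieldDegreePositive.
Variables (k : closedFieldType) (iota : {rmorphism 'F_2 -> k}).
Hypothesis k_algebraic : integralRange iota.
Local Notation kF := (restrict_scalars iota).

(** A dependent spanning family can be shortened by one vector. *)
Lemma span_basis (F : fieldType) (V : lmodType F) (U : set V) N (b : 'I_N -> V) :
  (forall i, U (b i)) ->
  (forall v, U v -> exists c : 'I_N -> F, v = \sum_i c i *: b i) ->
  exists n (b' : 'I_n -> V), is_basis_mod U [set 0] b'.
Proof.
elim: N b => [|N IHN] b bU b_span.
  exists 0%N, b; split=> // [v /b_span [c ->]|c _ [] //].
  by exists c; rewrite /= subrr.
have [b_free|] := pselect (forall c : 'I_N.+1 -> F,
    \sum_i c i *: b i = 0 -> forall i, c i = 0).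
  exists N.+1, b; split=> // v /b_span [c ->].
  by exists c; rewrite /= subrr.
move=> /existsNP [c /not_implyP [c0 /existsNP [i /eqP ci]]].
apply: (IHN (fun j : 'I_N => b (fintype.lift i j))) => [j|v /b_span [d ->]]; first exact: bU.
have bi : b i = \sum_j (- (c i)^-1 * c (fintype.lift i j)) *: b (fintype.lift i j).
  have -> : b i = (c i)^-1 *: (c i *: b i) by rewrite scalerA mulVf // scale1r.
  move: c0; rewrite (bigD1_ord i) //= => /eqP; rewrite addr_eq0 => /eqP ->.
  rewrite scalerN scaler_sumr -sumrN; apply: eq_bigr => j _.
  by rewrite scalerA mulNr scaleNr.
exists (fun j => d (fintype.lift i j) - d i * (c i)^-1 * c (fintype.lift i j)).
rewrite (bigD1_ord i) //= {1}bi scaler_sumr -big_split; apply: eq_bigr => j _ /=.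
by rewrite scalerA -scalerDl mulrA mulrN addrC mulNr.
Qed.

(** The powers [beta^(2^i)] lie in the finite ring [F_2[beta]], so two of them
    agree, and the Frobenius map is injective. *)
Lemma frobenius_periodic (beta : k) :
  exists2 d, (0 < d)%N & beta ^+ (2 ^ d) = beta.
Proof.
have [p p_monic p_root] := k_algebraic beta.
pose N := (size p).-1; pose r i : 'rV['F_2]_N := poly_rV ('X^(2 ^ i) %% p).
have [i [j [ij rij]]] : exists i j : nat, (i < j)%N /\ r i = r j.
  have : ~~ injectiveb (fun i : 'I_(#|{: 'rV['F_2]_N}|).+1 => r i).
    apply/negP => /injectiveP /leq_card; rewrite card_ord ltnn //.
  case/injectivePn => i [j ij rij].
  have [lt_ij|lt_ji|/val_inj E] := ltngtP i j.
  - by exists i, j.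
  - by exists j, i.
  - by rewrite E eqxx in ij.
have ev l : beta ^+ (2 ^ l) = (map_poly iota ('X^(2 ^ l) %% p)).[beta].
  have := divp_eq ('X^(2 ^ l)) p => /(congr1 (fun s => (map_poly iota s).[beta])).
  rewrite rmorphD rmorphM /= hornerD hornerM (eqP p_root) mulr0 add0r => <-.
  by rewrite map_polyXn hornerXn.
have modE : 'X^(2 ^ i) %% p = 'X^(2 ^ j) %% p.
  have sz l : (size ('X^(2 ^ l) %% p)%R <= N)%N.
    by rewrite -ltnS prednK ?ltn_modp ?monic_neq0 // size_poly_gt0 monic_neq0.
  by rewrite -[LHS](poly_rV_K (sz i)) -[RHS](poly_rV_K (sz j)); congr rVpoly.
exists (j - i)%N; first by rewrite subn_gt0.
have : beta ^+ (2 ^ i) = (beta ^+ (2 ^ (j - i))) ^+ (2 ^ i).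
  by rewrite -exprM -expnD subnK ?(ltnW ij) // !ev modE.
have pchar_k := pchar_closure iota.
by move=> /(qroot_unique pchar_k) E; rewrite [RHS]E; apply: qroot_unique.
Qed.

(** The elements fixed by a power of the Frobenius map form a finite subfield,
    which contains [beta] for a suitable power. *)
Lemma adjoin_finite (beta : k) :
  exists s : seq k, forall x, adjoin iota beta x -> x \in s.
Proof.
have [d d_gt0 betaE] := frobenius_periodic beta.
have pchar_k := pchar_closure iota.
have q_gt1 : (1 < 2 ^ d)%N by rewrite -{1}(expn0 2) ltn_exp2l.
have [s sE] := closed_field_poly_normal ('X^(2 ^ d) - 'X : {poly k}).
have pq : 'X^(2 ^ d) - 'X != 0 :> {poly k}.
  apply/eqP => /(congr1 (fun p : {poly k} => p`_1)).
  rewrite coefB coefXn coefX eqxx coef0 eq_sym; move: (gtn_eqF q_gt1) => ->.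
  by rewrite sub0r => /eqP; rewrite oppr_eq0 oner_eq0.
exists s => x; rewrite /adjoin /= => /(_ [pred y | y ^+ (2 ^ d) == y]) H.
have : x \in [pred y : k | y ^+ (2 ^ d) == y]; first apply: H.
- split=> [|y z|y z]; rewrite !inE ?expr1n //.
    by move=> /eqP yE /eqP zE; rewrite (oppr_pchar2 pchar_k) (exprD_pchar pchar_k) yE zE.
  by move=> /eqP yE /eqP zE; rewrite expr_div_n yE zE.
- move=> a; rewrite inE -rmorphXn; apply/eqP; congr (iota _).
  have a2 : a ^+ 2 = a by have := expf_card a; rewrite card_Fp.
  by elim: (d) => [|d' IHd]; rewrite ?expr1 // expnS exprM a2.
- by rewrite inE betaE.
rewrite inE => /eqP xE; have : root ('X^(2 ^ d) - 'X : {poly k}) x.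
  by rewrite /root !hornerE xE subrr.
by rewrite sE rootZ ?lead_coef_eq0 // root_prod_XsubC.
Qed.

(** The degree could only vanish if [F_2(beta)] were infinite-dimensional. *)
Lemma field_degree_gt0 (beta : k) : (0 < field_degree iota beta)%N.
Proof.
have [s sP] := adjoin_finite beta; pose U : set kF := adjoin iota beta.
pose s' := [seq x <- s | `[< adjoin iota beta x >]].
have [n [b bP]] : exists n (b : 'I_n -> kF), is_basis_mod U [set 0] b.
  apply: (@span_basis _ kF U (size s') (fun i => s'`_i)) => [i|v Uv].
    by have := mem_nth 0 (ltn_ord i); rewrite mem_filter => /andP [/asboolP].
  have vs : v \in s' by rewrite mem_filter (sP v Uv) andbT; apply/asboolP.
  have vi : (index v s' < size s')%N by rewrite index_mem.
  exists (fun i => (i == Ordinal vi)%:R); rewrite (bigD1 (Ordinal vi)) //= eqxx.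
  rewrite scale1r nth_index // big1 ?addr0 // => i /negPf ->.
  by rewrite scale0r.
rewrite /field_degree /dim_mod; case: xgetP => [N _ /=|/(_ n) []]; last by exists b.
move=> [b' [_ b'_span _]]; case: N b' b'_span => // b' b'_span.
have [|c] := b'_span (1 : kF).
  by move=> S Sdiv _ _; have [] := Sdiv.
by rewrite big_ord0 subr0 => /eqP; rewrite oner_eq0.
Qed.

End FieldDegreePositive.

(** * The sums of the brackets *)

Section BracketSums.
Variables (m : nat) (P : bool).

(** [f_ m P n j] with [n > 0] is a multiple of [C] plus at most one of [A_n] and
    [B_n]: [Some false] stands for [A_n], [Some true] for [B_n], and the number
    is the coefficient of [C]. *)
Definition state : Type := option bool * nat.

Definition Gamma_of (n : nat) (s : state) : Gamma :=
  (if s.1 is Some b then (if b then << SB n >> else << SA n >>) else 0)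
  + << SC >> *+ s.2.

Definition step (i : bool) (n : nat) (s : state) : state :=
  match s.1 with
  | Some false => (Some (hits m P i n.+1), s.2)
  | Some true => if hits m P i n then (None, s.2) else (Some false, s.2.+1)
  | None => s
  end.

Fixpoint run (n j : nat) : state :=
  if n is n'.+1 then
    if n' is 0 then (if odd j then None else Some false, 2)
    else step (odd j) n' (run n' j./2)
  else (None, 0).

Lemma sigmaU i s : sigma m P i << s >> = sigma_symbol m P i s.
Proof. by rewrite /sigma liftU scale1r. Qed.

HB.instance Definition _ i := GRing.isZmodMorphism.Build Gamma Gamma
  (sigma m P i) (lift_is_additive (sigma_symbol m P i)).

Lemma sigma_step i n s : sigma m P i (Gamma_of n s) = Gamma_of n.+1 (step i n s).
Proof.
case: s => [[[]|] c]; rewrite /Gamma_of /= raddfD raddfMn /= !sigmaU /=.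
- by rewrite /step /=; case: ifP => _ //=; rewrite mulrSr addrA addrAC -addrA.
- by rewrite /step /=; case: ifP.
- by rewrite raddf0.
Qed.

Lemma f_run n j : f_ m P n.+1 j = Gamma_of n.+1 (run n.+1 j).
Proof.
elim: n j => [|n IHn] j.
  have -> : f_ m P 1 j = sigma m P (odd j) (<< SC >> *+ 2 + << SD >>) by [].
  rewrite raddfD raddfMn /= !sigmaU /= addrC /Gamma_of /=.
  by case: (odd j).
transitivity (sigma m P (odd j) (f_ m P n.+1 j./2)); first by [].
by rewrite IHn sigma_step.
Qed.

(** The values [2^c] of the brackets, collected separately over the [j] for which
    [A_n], respectively [B_n], occurs. *)
Definition weightA (s : state) : nat := if s.1 is Some false then 2 ^ s.2 else 0.
Definition weightB (s : state) : nat := if s.1 is Some true then 2 ^ s.2 else 0.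

Lemma bracket_value n j (f := f_ m P n.+1 j) :
  (3 * coeff (SA n.+1) f + 5 * coeff (SB n.+1) f + coeff SD f)%:~R * 2 ^ coeff SC f
  = (3 * weightA (run n.+1 j) + 5 * weightB (run n.+1 j))%:R :> rat.
Proof.
rewrite /f f_run /Gamma_of /weightA /weightB; case: (run n.+1 j) => [[[]|] c] /=;
  rewrite !(coeffD, coeffMn, coeffU, coeff0) !eqE /= ?eqxx.
all: rewrite ?mul1r ?mulr0 ?mul0r ?mulr1 ?mul0rn ?addr0 ?add0r ?muln0 ?addn0 ?add0n.
all: rewrite ?natz ?natrM ?natrX -?exprnP //.
all: rewrite ?mul0r //.
Qed.

Local Open Scope nat_scope.

Lemma sum_double N (h : nat -> nat) :
  (\sum_(j < N.*2) h j = \sum_(j < N) (h j.*2 + h j.*2.+1))%N.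
Proof.
elim: N => [|N IHN]; first by rewrite !big_ord0.
by rewrite doubleS !big_ord_recr /= IHN addnA.
Qed.

Definition sumA n : nat := \sum_(j < 2 ^ n) weightA (run n j).
Definition sumB n : nat := \sum_(j < 2 ^ n) weightB (run n j).

Lemma hits_xor t : hits m P true t = (m %| t) && ~~ hits m P false t.
Proof. by rewrite /hits; case: (m %| t); case: (odd _); case: P. Qed.

Lemma hits_dvd i t : hits m P i t -> m %| t.
Proof. by case/andP. Qed.

(** A symbol [B_n] is only created when [m] divides [n]. *)
Lemma run_B n j c : run n.+1 j = (Some true, c) -> m %| n.+1.
Proof.
case: n => [|n]; first by rewrite /=; case: (odd j).
rewrite [run _ _]/(step (odd j) n.+1 (run n.+1 j./2)) /step.
case: (run n.+1 j./2) => [[[]|] d] //=; first by case: ifP.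
by case=> /hits_dvd.
Qed.

Local Arguments run : simpl never.

Lemma sum_run (F : state -> nat) n :
  (\sum_(j < 2 ^ n.+2) F (run n.+2 j) =
   \sum_(j < 2 ^ n.+1) (F (step false n.+1 (run n.+1 j))
                        + F (step true n.+1 (run n.+1 j))))%N.
Proof.
rewrite [2 ^ n.+2]expnS mul2n (sum_double _ (fun j => F (run n.+2 j))).
apply: eq_bigr => j _.
rewrite -[run n.+2 _]/(step (odd _) n.+1 (run n.+1 _./2)).
rewrite -[run n.+2 _.+1]/(step (odd _) n.+1 (run n.+1 _./2)).
by rewrite doubleK /= odd_double uphalf_double.
Qed.

(** If [m] divides the relevant index then exactly one of the two children of a
    symbol is affected, whichever of the two parities is [P]; so the sums satisfy
    a linear recursion. *)
Lemma sumA_rec n :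
  sumA n.+2 = ((if m %| n.+2 then 1 else 2) * sumA n.+1 + 2 * sumB n.+1)%N.
Proof.
rewrite /sumA sum_run /sumB !big_distrr -big_split; apply: eq_bigr => j _ /=.
have := @run_B n j; case: (run n.+1 j) => [[[]|] c] runB;
  rewrite /step /weightA /weightB /= ?hits_xor.
- by rewrite (runB c erefl); case: ifP => _ /=; rewrite (expnS 2 c); lia.
- case mn: (m %| n.+2); case E: (hits m P false n.+2) => /=; try lia.
  by move: (hits_dvd E); rewrite mn.
- by lia.
Qed.

Lemma sumB_rec n : sumB n.+2 = (if m %| n.+2 then sumA n.+1 else 0)%N.
Proof.
have -> : (if m %| n.+2 then sumA n.+1 else 0)%N =
          ((if m %| n.+2 then 1 else 0) * sumA n.+1)%N.
  by case: ifP; rewrite ?mul1n ?mul0n.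
rewrite /sumB sum_run /sumA big_distrr; apply: eq_bigr => j _ /=.
case: (run n.+1 j) => [[[]|] c];
  rewrite /step /weightA /weightB /= ?hits_xor.
- by case: ifP => _; case: ifP => _ /=; lia.
- case mn: (m %| n.+2); case E: (hits m P false n.+2) => /=; try lia.
  by move: (hits_dvd E); rewrite mn.
- by lia.
Qed.

Lemma sumA1 : sumA 1 = 4. Proof. by rewrite /sumA !big_ord_recl big_ord0. Qed.
Lemma sumB1 : sumB 1 = 0. Proof. by rewrite /sumB !big_ord_recl big_ord0. Qed.

Lemma sums_gt1 n : (1 < m)%N ->
  sumA n.+1 = (2 ^ (if m %| n.+1 then n.+1 else n.+2))%N /\
  sumB n.+1 = (if m %| n.+1 then 2 ^ n.+1 else 0)%N.
Proof.
move=> m_gt1; elim: n => [|n [IHA IHB]].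
  by rewrite sumA1 sumB1 dvdn1 gtn_eqF.
rewrite sumA_rec sumB_rec IHA IHB.
have [mn2|] := boolP (m %| n.+2); last by case: ifP => _ _; rewrite !expnS; lia.
rewrite ifN; first by rewrite ifN ?muln0 ?addn0 ?mul1n //;
  apply: contraTN mn2 => mn1; rewrite -addn1 dvdn_addr // dvdn1 gtn_eqF.
by apply: contraTN mn2 => mn1; rewrite -addn1 dvdn_addr // dvdn1 gtn_eqF.
Qed.

(** The recursion has the eigenvalues [2] and [-1], with the eigenforms [A + B]
    and [A - 2 * B]; the second one takes the values [4] and [-4]. *)
Lemma sums_eq1 n : m = 1%N ->
  (sumA n.+1 + sumB n.+1 = 2 ^ n.+2)%N /\
  (sumA n.+1 + (if odd n then 4 else 0) = 2 * sumB n.+1 + (if odd n then 0 else 4))%N.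
Proof.
move=> m1; elim: n => [|n [IH1 IH2]]; first by rewrite sumA1 sumB1.
rewrite sumA_rec sumB_rec m1 dvd1n mul1n [(2 ^ n.+3)%N]expnS -IH1 /=.
by move: IH2; case: (odd n) => /=; lia.
Qed.

End BracketSums.

Arguments run : simpl never.

(** * The recursion for the Hilbert-Kunz function *)

Section Recursion.
Variables (k : closedFieldType) (iota : {rmorphism 'F_2 -> k}) (alpha : k).
Hypothesis bracketE : forall n j : nat, (1 <= n)%N -> (j < 2 ^ n)%N ->
  bracket iota n j alpha =
  (e_ n.+1 (g_ alpha ^+ (2 * j + 1)))%:R
  - 1 / 2 * ((e_ n.+1 (g_ alpha ^+ (2 * j)))%:R
             + (e_ n.+1 (g_ alpha ^+ (2 * j + 2)))%:R).

Let pchar_k := pchar_closure iota.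
Let m := field_degree iota alpha.
Let P := field_degree iota (artin_schreier_root alpha) == m.

(** All terms of [g] lie in [(x^2, y^2, z^2)], so the four summands of [e_G] are
    [0], [8], [8] and [8]. *)
Lemma e_G1 : e_ 1 (G_ alpha) = 24.
Proof.
rewrite (e_G pchar_k) !big_ord_recl big_ord0 /= expr0 e_one expr1.
have g0 : box0 (2 ^ 1) (ps_of_mpoly (g_ alpha)).
  have X2 (i : 'I_3) : box0 2 (ps_of_mpoly 'X_i ^+ 2 : powerseries 3 k).
    rewrite -rmorphXn mpolyXn; apply: box0X; apply/forallPn; exists i.
    by rewrite mulmnE mnm1E eqxx.
  rewrite /g_ /g_form !(rmorphD, rmorphM, rmorphXn) /= ps_of_mpolyZ.
  rewrite rmorphM !rmorphXn /=; apply: box0D.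
    apply: box0D; last exact/box0M/X2.
    apply: box0D; first exact/box0Z/box0M/X2.
    exact/box0M/box0M/X2.
  by rewrite mulrC; apply/box0M/box0D; apply/box0M/X2.
rewrite e_box0 // e_box0 // rmorphXn; exact: box0M.
Qed.

(** In [e_G] the even powers of [g] are squares and contribute [8] times the
    previous values, while the hypothesis expresses each odd power by its two
    even neighbours and a bracket. *)
Lemma e_G_rec n :
  e_ n.+2 (G_ alpha) =
  (16 * e_ n.+1 (G_ alpha) + 2 * (3 * sumA m P n.+1 + 5 * sumB m P n.+1))%N.
Proof.
rewrite !(e_G pchar_k) [(2 ^ n.+2)%N]expnS mul2n.
rewrite (sum_double _ (fun j =>
  e_ n.+2 (g_ alpha ^+ j) + e_ n.+2 (g_ alpha ^+ j.+1))%N) /sumA /sumB.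
rewrite !big_distrr /= -!big_split !big_distrr -!big_split /=.
apply: eq_bigr => j _; pose D i := e_ n.+2 (g_ alpha ^+ i).
have D2 i : D i.*2 = (8 * e_ n.+1 (g_ alpha ^+ i))%N.
  by rewrite /D -muln2 exprM (e_double _ _ pchar_k).
have := bracketE (ltn0Sn n) (ltn_ord j); rewrite /bracket /= bracket_value.
rewrite addn1 addn2 mul2n -doubleS -!/(D _) => vE.
move: vE; rewrite -/m -/P; move: (3 * _ + 5 * _)%N => v vE.
have {}vE : (2 * v + D j.*2 + D j.+1.*2 = 2 * D j.*2.+1)%N.
  by apply/eqP; rewrite -(eqr_nat rat) !natrD vE; apply/eqP; field.
rewrite !D2 in vE *; move: vE; lia.
Qed.

End Recursion.

(** * Closed forms and limits *)

Section ClosedForms.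
Variables (k : closedFieldType) (iota : {rmorphism 'F_2 -> k}) (alpha : k).
Hypothesis bracketE : forall n j : nat, (1 <= n)%N -> (j < 2 ^ n)%N ->
  bracket iota n j alpha =
  (e_ n.+1 (g_ alpha ^+ (2 * j + 1)))%:R
  - 1 / 2 * ((e_ n.+1 (g_ alpha ^+ (2 * j)))%:R
             + (e_ n.+1 (g_ alpha ^+ (2 * j + 2)))%:R).
Local Notation m := (field_degree iota alpha).

Lemma expr8_neq1 (F : realFieldType) d : (0 < d)%N -> 8 ^+ d - 1 != 0 :> F.
Proof. by move=> d0; rewrite subr_eq0 gt_eqF // exprn_egt1 ?ltr1n // -lt0n. Qed.

(** The last term vanishes for [n < m]; in general it depends on the position of
    [n] in its period modulo [m], because the sum of the brackets is larger when
    [m] divides the index. *)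
Lemma e_G_gt1 (F : realFieldType) n : (1 < m)%N ->
  (e_ n.+1 (G_ alpha))%:R =
    45 / 28 * 16 ^+ n.+1 - 6 / 7 * 2 ^+ n.+1
    + (16 ^+ n.+1 - 2 ^+ n.+1 * 8 ^+ (n %% m).+1) / (4 * (8 ^+ m - 1)) :> F.
Proof.
move=> m_gt1; have := @expr8_neq1 F m (ltnW m_gt1).
elim: n => [|n IHn] y1.
  by rewrite (e_G1 iota) mod0n; field.
rewrite (e_G_rec bracketE) natrD !natrM IHn // natrD !natrM.
have [-> ->] := sums_gt1 (field_degree iota (artin_schreier_root alpha) == m) n m_gt1.
rewrite modnS; case: ifPn => mn.
  have -> : (n %% m).+1 = m.
    have m_gt0 := ltnW m_gt1; apply/eqP; rewrite eqn_leq ltn_pmod //=.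
    apply: dvdn_leq => //; move: mn.
    by rewrite {1}(divn_eq n m) -addnS dvdn_addr // dvdn_mull.
  by rewrite natrX !exprS expr0; field.
by rewrite natrX !exprS; field.
Qed.

Lemma e_G_eq1 (F : realFieldType) n : m = 1%N ->
  (e_ n.+1 (G_ alpha))%:R =
    767 / 476 * 16 ^+ n.+1 - 22 / 21 * 2 ^+ n.+1 - 16 / 51 * (-1) ^+ n.+1 :> F.
Proof.
move=> m1; elim: n => [|n IHn]; first by rewrite (e_G1 iota); field.
rewrite (e_G_rec bracketE) natrD !natrM IHn // natrD !natrM.
have [] := sums_eq1 (field_degree iota (artin_schreier_root alpha) == m) n m1.
set a := sumA _ _ _; set b := sumB _ _ _ => ab1 ab2.
have {}ab1 : a%:R + b%:R = 2 ^+ n.+2 :> F by rewrite -natrD ab1 natrX.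
have {}ab2 : a%:R - 2 * b%:R = 4 * (-1) ^+ n :> F.
  have := congr1 (fun c => c%:R : F) ab2; rewrite -signr_odd !natrD.
  by case: (odd n) => /= E; lra.
have -> : b%:R = (2 ^+ n.+2 - 4 * (-1) ^+ n) / 3 :> F by lra.
have -> : a%:R = (2 * 2 ^+ n.+2 + 4 * (-1) ^+ n) / 3 :> F by lra.
by rewrite !exprS; field.
Qed.

End ClosedForms.

Lemma cvg_geometric_bound (K : realType) (u : nat -> K) (L C : K) :
  (forall n, (0 < n)%N -> `|u n - L| <= C * 8^-1 ^+ n) -> u @ \oo --> L.
Proof.
move=> uL; have g0 : geometric C (8^-1 : K) @ \oo --> (0 : K).
  by apply: cvg_geometric; rewrite ger0_norm ?invr_ge0 // invf_lt1 // ltr1n.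
apply/subr_cvg0; apply: norm_cvg0; apply: (squeeze_cvgr _ (cvg_cst 0) g0).
by near=> n; rewrite normr_ge0 /=; apply: uL; near: n; exact: nbhs_infty_gt.
Unshelve. all: by end_near.
Qed.

Section Limits.
Variables (K : realType) (k : closedFieldType) (iota : {rmorphism 'F_2 -> k}).
Variables (k_algebraic : integralRange iota) (alpha : k).
Hypothesis bracketE : forall n j : nat, (1 <= n)%N -> (j < 2 ^ n)%N ->
  bracket iota n j alpha =
  (e_ n.+1 (g_ alpha ^+ (2 * j + 1)))%:R
  - 1 / 2 * ((e_ n.+1 (g_ alpha ^+ (2 * j)))%:R
             + (e_ n.+1 (g_ alpha ^+ (2 * j + 2)))%:R).
Local Notation m := (field_degree iota alpha).

Definition HK_limit : K :=
  if m == 1%N then 767 / 476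
  else (45 * 2 ^+ (3 * m) - 38) / (7 * 2 ^+ (3 * m + 2) - 28).

Lemma e_G_cvg :
  (fun n => (e_ n (G_ alpha))%:R / (2 ^ (n * 4))%:R : K) @ \oo --> HK_limit.
Proof.
have pow16 n : (2 ^ (n * 4))%:R = 2 ^+ n * 8 ^+ n :> K.
  by rewrite natrX mulnC exprM -exprMn; congr (_ ^+ _); ring.
have pow28 n : 16 ^+ n = 2 ^+ n * 8 ^+ n :> K by rewrite -exprMn; congr (_ ^+ _); ring.
rewrite /HK_limit; case: ifPn => [/eqP m1|m_neq1].
  apply: (@cvg_geometric_bound _ _ _ 2) => -[//|n] _.
  rewrite pow16 (e_G_eq1 bracketE _ _ m1) pow28.
  have x0 : 0 < 2 ^+ n.+1 :> K by rewrite exprn_gt0.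
  have x1 : 1 <= 2 ^+ n.+1 :> K by rewrite exprn_ege1 // ler1n.
  have y0 : 0 < 8 ^+ n.+1 :> K by rewrite exprn_gt0.
  have -> : (767 / 476 * (2 ^+ n.+1 * 8 ^+ n.+1) - 22 / 21 * 2 ^+ n.+1
      - 16 / 51 * (-1) ^+ n.+1) / (2 ^+ n.+1 * 8 ^+ n.+1) - 767 / 476
    = - (22 / 21 + 16 / 51 * (-1) ^+ n.+1 / 2 ^+ n.+1) * 8^-1 ^+ n.+1 :> K.
    by rewrite exprVn; field; rewrite !gt_eqF.
  rewrite normrM [`|8^-1 ^+ _|]ger0_norm ?exprn_ge0 ?invr_ge0 //.
  rewrite ler_wpM2r ?exprn_ge0 ?invr_ge0 // normrN.
  have : `|(-1) ^+ n.+1 / 2 ^+ n.+1| <= 1 :> K.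
    by rewrite normrM normrX normrN1 expr1n mul1r normfV gtr0_norm // invf_le1.
  rewrite -mulrA !ler_norml; move: (_ / 2 ^+ n.+1) => t /andP [t1 t2].
  by apply/andP; split; lra.
have m_gt1 : (1 < m)%N by rewrite ltn_neqAle eq_sym m_neq1 field_degree_gt0.
have y1 := @expr8_neq1 K m (ltnW m_gt1).
have -> : (45 * 2 ^+ (3 * m) - 38) / (7 * 2 ^+ (3 * m + 2) - 28) =
    45 / 28 + (4 * (8 ^+ m - 1))^-1 :> K.
  rewrite exprD exprM (_ : 2 ^+ 3 = 8) ?expr2; last by ring.
  have -> : 7 * (8 ^+ m * (2 * 2)) - 28 = 28 * (8 ^+ m - 1) :> K by ring.
  by field.
pose C : K := 6 / 7 + 8 ^+ m / (4 * (8 ^+ m - 1)).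
apply: (@cvg_geometric_bound _ _ _ C) => -[//|n] _.
have y_gt0 : 0 < 8 ^+ m - 1 :> K by rewrite subr_gt0 exprn_egt1 ?ltr1n // -lt0n ltnW.
rewrite pow16 (e_G_gt1 bracketE) // pow28.
have x0 : 2 ^+ n.+1 != 0 :> K by rewrite gt_eqF // exprn_gt0.
have z0 : 8 ^+ n.+1 != 0 :> K by rewrite gt_eqF // exprn_gt0.
set r := (n %% m).+1.
have -> : (45 / 28 * (2 ^+ n.+1 * 8 ^+ n.+1) - 6 / 7 * 2 ^+ n.+1
    + (2 ^+ n.+1 * 8 ^+ n.+1 - 2 ^+ n.+1 * 8 ^+ r) / (4 * (8 ^+ m - 1)))
    / (2 ^+ n.+1 * 8 ^+ n.+1) - (45 / 28 + (4 * (8 ^+ m - 1))^-1)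
  = - ((6 / 7 + 8 ^+ r / (4 * (8 ^+ m - 1))) * 8^-1 ^+ n.+1) :> K.
  by rewrite exprVn; field; rewrite z0 x0 y1.
have c0 : 0 <= 6 / 7 + 8 ^+ r / (4 * (8 ^+ m - 1)) :> K.
  by rewrite addr_ge0 // divr_ge0 ?exprn_ge0 // mulr_ge0 // ltW.
rewrite normrN ger0_norm ?mulr_ge0 ?exprn_ge0 ?invr_ge0 //.
rewrite ler_wpM2r ?exprn_ge0 ?invr_ge0 // lerD2l ler_wpM2r //.
  by rewrite invr_ge0 mulr_ge0 // ltW.
by rewrite ler_weXn2l ?ler1n // ltn_pmod // ltnW.
Qed.

Lemma Fsig_cvg :
  (fun n => (2 * (2 ^ n) ^ 4 - e_ n (G_ alpha))%:R / (2 ^ (n * 4))%:R : K) @ \oo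
  --> 2 - HK_limit.
Proof.
have -> : (fun n => (2 * (2 ^ n) ^ 4 - e_ n (G_ alpha))%:R / (2 ^ (n * 4))%:R : K)
  = (fun n => 2 - (e_ n (G_ alpha))%:R / (2 ^ (n * 4))%:R).
  apply/funext => n; rewrite natrB ?(e_G_leq (pchar_closure iota)) // mulrBl.
  by rewrite natrM -expnM mulfK // natrX gt_eqF // exprn_gt0.
by apply: cvgB; [apply: cvg_cst|apply: e_G_cvg].
Qed.

End Limits.

Theorem theorem2p19 (K : realType) (k : closedFieldType)
    (iota : {rmorphism 'F_2 -> k}) (k_algebraic : integralRange iota)
    (bracketE : forall (alpha : k) (n j : nat),
       alpha != 0 -> (1 <= n)%N -> (j < 2 ^ n)%N ->
       bracket iota n j alpha =
       (e_ n.+1 (g_ alpha ^+ (2 * j + 1)))%:R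
       - 1 / 2 * ((e_ n.+1 (g_ alpha ^+ (2 * j)))%:R
                  + (e_ n.+1 (g_ alpha ^+ (2 * j + 2)))%:R))
    (alpha : k) (alpha_neq0 : alpha != 0) :
  let m := field_degree iota alpha in
  [/\ forall n : nat, (1 <= n)%N -> (n < m)%N ->
        (e_ n (G_ alpha))%:R =
        45 / 28 * 2 ^+ (4 * n) - 3 / 7 * 2 ^+ n.+1 :> rat,
      is_HK_multiplicity 2 4 (R_ alpha)
        (if m == 1%N then 767 / 476 : K
         else (45 * 2 ^+ (3 * m) - 38) / (7 * 2 ^+ (3 * m + 2) - 28))
    & is_F_signature 4 (R_pchar alpha (pchar_closure iota))
        (if m == 1%N then 185 / 476 : K
         else (11 * 2 ^+ (3 * m) - 18) / (7 * 2 ^+ (3 * m + 2) - 28))].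
Proof.
have bE n j := @bracketE alpha n j alpha_neq0.
have pchar_k := pchar_closure iota.
move=> m; have m_gt0 : (0 < m)%N := field_degree_gt0 k_algebraic alpha.
have e_cvg := @e_G_cvg K k iota k_algebraic alpha bE.
split=> [n n_gt0 nm||].
- case: n n_gt0 nm => // n _ nm.
  rewrite (e_G_gt1 bE) ?(leq_ltn_trans _ nm) // modn_small; last exact: ltnW.
  rewrite (exprM _ 4) (_ : 2 ^+ 4 = 16 :> rat) //.
  have pow28 : 2 ^+ n.+1 * 8 ^+ n.+1 = 16 ^+ n.+1 :> rat.
    by rewrite -exprMn; congr (_ ^+ _).
  by rewrite pow28 subrr mul0r addr0 [2 ^+ n.+2]exprS; field.
- by exists (fun e => e_ e (G_ alpha)); split=> // e; apply: length_HK.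
- exists (fun e => 2 * (2 ^ e) ^ 4 - e_ e (G_ alpha))%N.
  split=> [e|]; first exact: length_Fsig.
  suff -> : (if m == 1%N then 185 / 476 : K
      else (11 * 2 ^+ (3 * m) - 18) / (7 * 2 ^+ (3 * m + 2) - 28)) =
      2 - HK_limit K iota alpha by apply: (Fsig_cvg k_algebraic).
  rewrite /HK_limit -/m; case: ifP => _; first by field.
  have y1 := @expr8_neq1 K m m_gt0.
  rewrite exprD exprM (_ : 2 ^+ 3 = 8) ?expr2; last by ring.
  have -> : 7 * (8 ^+ m * (2 * 2)) - 28 = 28 * (8 ^+ m - 1) :> K by ring.
  by field.
Qed.
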